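(* The odd Schur functions are signed-orthonormal: for all partitions $\lambda,\mu$ of $n$, $$(s_\lambda,s_\mu)=(-1)^{\binom{\lambda^T}{2}}\delta_{\lambda,\mu}.$$
   Context: The algebra of odd symmetric functions: let $\Bbbk$ be a commutative ring and $\Lambda'$ the free associative $\mathbb{Z}$-graded $\Bbbk$-algebra on $h_1,h_2,\dots$ with $\deg h_n=n$; $h_0=1$. For a composition $\alpha=(a_1,\dots,a_k)$ (finite sequence of positive integers) put $h_\alpha=h_{a_1}\cdots h_{a_k}$, $|\alpha|=a_1+\dots+a_k$, $S_\alpha=S_{a_1}\times\dots\times S_{a_k}\subset S_{|\alpha|}$. The symmetric bilinear form on $\Lambda'$ is $(h_\beta,h_\alpha)=\sum_{c\in S_\beta\backslash S_n/S_\alpha}(-1)^{\ell(c)}$ if $|\alpha|=|\beta|=n$, and $0$ if $|\alpha|\ne|\beta|$, where $\ell(c)$ is the Coxeter length of the minimal length element of $c$. Let $\mathcal I$ be the radical of the form and $\Lambda=\Lambda'/\mathcal I$ with the induced grading $\Lambda=\bigoplus_n\Lambda_n$, multiplication and form. The $h_\lambda$, $\lambda\vdash n$, form a basis of $\Lambda_n$. Odd Kostka numbers: for a semistandard Young tableau $T$ (entries positive integers, non-decreasing along rows, strictly increasing down columns), its row word $w_r(T)$ is obtained by reading the rows from left to right, from the bottom row to the top row; $\mathrm{sign}(T)$ is the sign of the minimal length permutation sorting $w_r(T)$ into non-decreasing order, i.e. $(-1)$ to the number of pairs of positions $i<j$ whose letters satisfy $w_i>w_j$. The content of $T$ is $(a_1,a_2,\dots)$,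 $a_i$ the number of entries equal to $i$. $T_\lambda$ is the unique semistandard tableau with shape and content both $\lambda$. For $\lambda,\mu\vdash n$, $K_{\lambda\mu}=\mathrm{sign}(T_\lambda)\sum_T\mathrm{sign}(T)$, sum over semistandard $T$ of shape $\lambda$ and content $\mu$. The odd Schur functions $s_\lambda\in\Lambda_n$, $\lambda\vdash n$, are defined by $h_\mu=\sum_{\lambda\vdash n}K_{\lambda\mu}s_\lambda$ for all $\mu\vdash n$. $\lambda^T$ is the transpose (conjugate) partition, and for a partition $\nu=(\nu_1,\nu_2,\dots)$, $\binom{\nu}{2}=\sum_i\binom{\nu_i}{2}$. *)

(* Defs.v *)
From HB Require Import structures.
From mathcomp Require Import boolp classical_sets.
From mathcomp Require Import all_boot all_order all_algebra all_fingroup.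
From mathcomp Require Import finmap monalg.

Set Implicit Arguments.
Unset Strict Implicit.
Unset Printing Implicit Defensive.

Import Order.TTheory GRing.Theory Num.Theory.

Definition is_part (s : seq nat) := sorted geq s && (0 \notin s).

Record intpart (n : nat) : predArgType := IntPart {
  intpart_val :> seq nat;
  _ : is_part intpart_val && (sumn intpart_val == n) }.

HB.instance Definition _ n := [isSub for @intpart_val n].
HB.instance Definition _ n := [Countable of intpart n by <:].

Lemma leq_mem_sumn (s : seq nat) x : x \in s -> x <= sumn s.
Proof.
elim: s => // y s IH; rewrite inE => /orP[/eqP->|/IH le] /=; first exact: leq_addr.
exact: leq_trans le (leq_addl _ _).
Qed.

Lemma leq_size_sumn (s : seq nat) : 0 \notin s -> size s <= sumn s.
Proof.
elim: s => // y s IH; rewrite inE negb_or eq_sym -lt0n => /andP[y0 /IH le] /=.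
by rewrite -addn1 addnC leq_add.
Qed.

Section IntpartFinite.
Variable n : nat.

Definition intpart_code (p : intpart n) : n.-bseq 'I_n.+1 :=
  insub_bseq n [seq inord x | x <- p].

Definition intpart_decode (t : n.-bseq 'I_n.+1) : option (intpart n) :=
  insub [seq val i | i <- t].

Lemma intpart_codeK : pcancel intpart_code intpart_decode.
Proof.
move=> p; have /andP[/andP[_ p0] /eqP pn] := valP p.
rewrite /intpart_decode /intpart_code insubdK; last first.
  by rewrite -[_ \in _]/(_ <= n) size_map -{2}pn leq_size_sumn.
rewrite -map_comp map_id_in ?valK // => x px /=.
by rewrite inordK // ltnS -pn leq_mem_sumn.
Qed.

HB.instance Definition _ : isFinite (intpart n) := PCanIsFinite intpart_codeK.
End IntpartFinite.

Definition conj_part (s : seq nat) : seq nat :=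
  mkseq (fun j => count (fun x => j < x) s) (head 0 s).

Definition binom2 (s : seq nat) : nat := \sum_(x <- s) 'C(x, 2).

(* A tableau is the sequence of its rows, from top to bottom. *)

Definition col_lt (r r' : seq nat) :=
  all (fun j => nth 0 r j < nth 0 r' j) (iota 0 (size r')).

Definition semistandard (T : seq (seq nat)) :=
  [&& is_part (shape T), 0 \notin flatten T, all (sorted leq) T
    & sorted col_lt T].

(* (a_1, ..., a_m) with m the largest entry of T *)
Definition content (T : seq (seq nat)) : seq nat :=
  mkseq (fun i => count_mem i.+1 (flatten T)) (\max_(x <- flatten T) x).

Definition row_word (T : seq (seq nat)) : seq nat := flatten (rev T).

Definition inversions (w : seq nat) : nat :=
  #|[set p : 'I_(size w) * 'I_(size w) |
      (p.1 < p.2) && (nth 0 w p.2 < nth 0 w p.1)]|.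

Definition tab_sign (T : seq (seq nat)) : int :=
  ((-1) ^+ inversions (row_word T))%R.

Record ssyt (la mu : seq nat) : predArgType := Ssyt {
  ssyt_val :> seq (seq nat);
  _ : [&& semistandard ssyt_val, shape ssyt_val == la
        & content ssyt_val == mu] }.

HB.instance Definition _ la mu := [isSub for @ssyt_val la mu].
HB.instance Definition _ la mu := [Countable of ssyt la mu by <:].

Lemma leq_max_content (T : seq (seq nat)) x :
  x \in flatten T -> x <= size (content T).
Proof. by move=> xT; rewrite size_mkseq; exact: leq_bigmax_seq. Qed.

Section SsytFinite.
Variables la mu : seq nat.
Let m := size la.
Let l := sumn la.
Let e := size mu.

Definition ssyt_code (T : ssyt la mu) : m.-bseq (l.-bseq 'I_e.+1) :=
  insub_bseq m [seq insub_bseq l [seq inord x | x <- r] | r <- val T].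

Definition ssyt_decode (t : m.-bseq (l.-bseq 'I_e.+1)) : option (ssyt la mu) :=
  insub [seq [seq val i | i <- bseqval r] | r <- bseqval t].

Lemma ssyt_codeK : pcancel ssyt_code ssyt_decode.
Proof.
move=> T; have /and3P[_ /eqP shT /eqP ctT] := valP T.
have szT : size (val T) <= m by rewrite -(size_map size) [map _ _]shT.
have rowT r : r \in val T -> size r <= l.
  by move=> rT; rewrite leq_mem_sumn // -shT map_f.
have entT x : x \in flatten (val T) -> x < e.+1.
  by move=> xT; rewrite ltnS /e -ctT leq_max_content.
rewrite /ssyt_decode /ssyt_code insubdK; last first.
  by rewrite -[_ \in _]/(_ <= m) size_map.
rewrite -map_comp map_id_in ?valK // => r rT /=.
rewrite insubdK; last by rewrite -[_ \in _]/(_ <= l) size_map rowT.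
rewrite -map_comp map_id_in // => x xr /=.
by rewrite inordK // entT //; apply/flattenP; exists r.
Qed.

HB.instance Definition _ : isFinite (ssyt la mu) := PCanIsFinite ssyt_codeK.
End SsytFinite.

(* T_lambda; see superstandard_ssyt and superstandard_uniq. *)
Definition superstandard (la : seq nat) : seq (seq nat) :=
  mkseq (fun i => nseq (nth 0 la i) i.+1) (size la).

Lemma shape_superstandard la : shape (superstandard la) = la.
Proof.
rewrite /shape -map_comp -[RHS](mkseq_nth 0); apply: eq_map => i /=.
by rewrite size_nseq.
Qed.

Lemma part_nth_gt0 la i : is_part la -> i < size la -> 0 < nth 0 la i.
Proof. by case/andP=> _ la0 ilt; rewrite lt0n (memPn la0) ?mem_nth. Qed.

Lemma count_superstandard la i :
  count_mem i.+1 (flatten (superstandard la)) = nth 0 la i.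
Proof.
rewrite count_flatten -map_comp sumnE big_map.
have -> : iota 0 (size la) = index_iota 0 (size la) by rewrite /index_iota subn0.
rewrite big_mkord.
have E (j : 'I_(size la)) : true ->
    count_mem i.+1 (nseq (nth 0 la j) j.+1) = (j == i :> nat) * nth 0 la j.
  by move=> _; rewrite count_nseq /= eqSS.
rewrite (eq_bigr _ E); have [lti|lei] := ltnP i (size la).
  rewrite (bigD1 (Ordinal lti)) //= eqxx mul1n big1 ?addn0 // => j.
  by rewrite -val_eqE => /negPf ->.
rewrite nth_default // big1 // => j _.
by rewrite (ltn_eqF (leq_trans (ltn_ord j) lei)).
Qed.

Lemma mem_superstandard la x :
  x \in flatten (superstandard la) -> 0 < x <= size la.
Proof.
by case/flattenP=> r /mapP[i]; rewrite mem_iota => ilt -> /nseqP[-> _].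
Qed.

Lemma superstandard_ssyt la : is_part la ->
  [&& semistandard (superstandard la), shape (superstandard la) == la
    & content (superstandard la) == la].
Proof.
move=> pla; rewrite /semistandard shape_superstandard pla eqxx /=.
apply/andP; split.
  apply/and3P; split.
  - by apply/negP=> /mem_superstandard.
  - apply/allP=> r /mapP[i _ ->]; elim: (nth 0 la i) => //= a IH.
    by case: a IH => //= a ->; rewrite leqnn.
  - apply/(sortedP [::]) => i; rewrite size_mkseq => ilt.
    rewrite !nth_mkseq ?(ltnW ilt) //; apply/allP=> j.
    rewrite size_nseq mem_iota /= => jlt; rewrite !nth_nseq jlt.
    have /andP[/(sortedP 0)/(_ i ilt) le _] := pla.
    by rewrite (leq_trans jlt le).
apply/eqP; rewrite /content (eq_mkseq (count_superstandard la)).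
suff -> : \max_(x <- flatten (superstandard la)) x = size la by exact: mkseq_nth.
apply/eqP; rewrite eqn_leq; apply/andP; split.
  by apply/bigmax_leqP_seq => x /mem_superstandard/andP[].
case E: (size la) => [//|m]; apply: leq_bigmax_seq => //.
by rewrite -has_pred1 has_count count_superstandard part_nth_gt0 // E.
Qed.

Lemma ssyt_entry_ge (T : seq (seq nat)) i j : semistandard T ->
  j < size (nth [::] T i) -> i < nth 0 (nth [::] T i) j.
Proof.
case/and4P=> /andP[/(sortedP 0) sh _] T0 _ /(sortedP [::]) cT.
elim: i => [|i IH] jlt.
  rewrite lt0n (memPn T0) //; apply/flattenP; exists (nth [::] T 0).
    by rewrite mem_nth //; case: (T) jlt.
  exact: mem_nth.
have ilt : i.+1 < size T by rewrite ltnNge; apply/negP=> le; rewrite nth_default in jlt.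
have lt : i < nth 0 (nth [::] T i) j.
  apply: IH; apply: leq_trans jlt _.
  have := sh i; rewrite size_map => /(_ ilt).
  by rewrite !(nth_map [::]) // ltnW.
by apply: leq_ltn_trans lt _; have /allP := cT i ilt; apply; rewrite mem_iota.
Qed.

Lemma count_content T i :
  count_mem i.+1 (flatten T) = nth 0 (content T) i.
Proof.
have [lti|lei] := ltnP i (\max_(x <- flatten T) x); first by rewrite nth_mkseq.
rewrite nth_default ?size_mkseq //; apply/count_memPn/negP=> iT.
have : i.+1 <= \max_(x <- flatten T) x by exact: leq_bigmax_seq.
by rewrite ltnNge lei.
Qed.

Lemma superstandard_uniq la (T : ssyt la la) : T = superstandard la :> seq _.
Proof.
have /and3P[sT /eqP shT /eqP cT] := valP T.
have pla : is_part la by rewrite -shT; case/and4P: sT.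
have /and3P[sS _ _] := superstandard_ssyt pla.
set S := superstandard la; set U := val T.
have szU : size U = size la by rewrite -(size_map size) [map _ _]shT.
have szS : size S = size la by rewrite size_mkseq.
have rowU i : size (nth [::] U i) = nth 0 la i.
  have [lt|le] := ltnP i (size U); first by rewrite -(nth_map _ 0) // [map _ _]shT.
  by rewrite !nth_default // -szU.
have perm : perm_eq (flatten U) (flatten S).
  apply/allP=> -[|i] _ /=; last by rewrite count_content cT count_superstandard.
  have /and4P[_ /count_memPn -> _ _] := sT; rewrite eq_sym; apply/eqP.
  by apply/count_memPn; case/and4P: sS.
have sumE (V : seq (seq nat)) : size V = size la ->
    (forall i, size (nth [::] V i) = nth 0 la i) ->
    sumn (flatten V) =
    \sum_(i < size la) \sum_(j < nth 0 la i) nth 0 (nth [::] V i) j.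
  move=> sV rV; rewrite sumn_flatten sumnE big_map (big_nth [::]) big_mkord sV.
  by apply: eq_bigr => i _; rewrite sumnE (big_nth 0) big_mkord rV.
have rowS i : nth [::] S i = nseq (nth 0 la i) i.+1.
  have [lt|le] := ltnP i (size la); first by rewrite nth_mkseq.
  by rewrite !nth_default // szS.
have := perm_sumn perm; rewrite !sumE // => [|i]; last by rewrite rowS size_nseq.
pose w := [fun i j => nth 0 (nth [::] U i) j].
have le (i : 'I_(size la)) (j : 'I_(nth 0 la i)) : i.+1 <= w i j.
  by apply: ssyt_entry_ge => //; rewrite rowU.
under [RHS]eq_bigr do under eq_bigr => j _ do rewrite rowS nth_nseq ltn_ord.
move=> eq.
have eq1 (i : 'I_(size la)) :
    \sum_(j < nth 0 la i) i.+1 = \sum_(j < nth 0 la i) w i j.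
  have /leqif_sum : forall i : 'I_(size la), true ->
    \sum_(j < nth 0 la i) i.+1 <= \sum_(j < nth 0 la i) w i j
      ?= iff (\sum_(j < nth 0 la i) i.+1 == \sum_(j < nth 0 la i) w i j).
    by move=> i' _; split=> //; apply: leq_sum => j _; apply: le.
  by case=> _; rewrite -eq eqxx => /esym/forallP/(_ i)/eqP.
have eq2 (i : 'I_(size la)) (j : 'I_(nth 0 la i)) : w i j = i.+1.
  have /leqif_sum : forall j : 'I_(nth 0 la i), true ->
    i.+1 <= w i j ?= iff (i.+1 == w i j).
    by move=> j' _; split=> //; apply: le.
  by case=> _; rewrite eq1 eqxx => /esym/forallP/(_ j)/eqP.
apply: (@eq_from_nth _ [::]) => [|i]; first by rewrite szS.
rewrite szU => ilt; apply: (@eq_from_nth _ 0) => [|j]; first by rewrite rowU rowS size_nseq.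
rewrite rowU => jlt; rewrite rowS nth_nseq jlt.
exact: (eq2 (Ordinal ilt) (Ordinal jlt)).
Qed.

Definition odd_kostka (la mu : seq nat) : int :=
  (tab_sign (superstandard la) * \sum_(T : ssyt la mu) tab_sign T)%R.

Section SymmetricGroup.
Variable n : nat.
Local Open Scope group_scope.

Definition simple_refls : {set 'S_n} :=
  [set tperm p.1 p.2 | p : 'I_n * 'I_n & p.2 == p.1.+1 :> nat].

Lemma tperm_simple_gen (d : nat) (i j : 'I_n) :
  j = (i + d)%N :> nat -> tperm i j \in <<simple_refls>>.
Proof.
elim: d j => [|d IH] j ij.
  suff -> : j = i by rewrite tperm1 group1.
  by apply: val_inj; rewrite /= ij addn0.
have lt_n : (i + d < n)%N by rewrite -ltnS -addnS -ij ltnS ltnW.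
pose k := Ordinal lt_n.
have tk : tperm k j \in <<simple_refls>>.
  by apply/mem_gen/imsetP; exists (k, j); rewrite ?inE //= ij addnS.
have [<-//|nik] := eqVneq k i.
have nij : i != j by rewrite -val_eqE /= ij -{1}[val i]addn0 eqn_add2l.
have <- : tperm i k ^ tperm k j = tperm i j.
  by rewrite tpermJ tpermL tpermD // eq_sym.
by rewrite groupJ // IH.
Qed.

Lemma simple_refls_gen : <<simple_refls>> = [set: 'S_n].
Proof.
apply/eqP; rewrite eqEsubset subsetT; apply/subsetP=> s _.
have [ts -> _] := prod_tpermP s; rewrite group_prod // => -[i j] _ /=.
have [le|lt] := leqP i j.
  by apply: (@tperm_simple_gen (j - i)); rewrite subnKC.
by rewrite tpermC; apply: (@tperm_simple_gen (i - j)); rewrite subnKC // ltnW.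
Qed.

(* A ^+ k is the k-fold product of the set A, hence the set of products of
   k simple transpositions. *)
Lemma simple_word_exists (w : 'S_n) :
  exists k, w \in simple_refls ^+ k.
Proof.
have : w \in <<simple_refls>> by rewrite simple_refls_gen inE.
case/gen_prodgP => k [c cS ->]; exists k.
elim: k c cS => [|k IH] c cS; first by rewrite big_ord0 expg0 inE.
by rewrite big_ord_recl expgS mem_mulg ?IH // => i; apply: cS.
Qed.

Definition coxeter_length (w : 'S_n) : nat := ex_minn (simple_word_exists w).

(* reshape_index a i is the block of a containing i, for the decomposition of
   {0, ..., n-1} into consecutive intervals of sizes a_1, a_2, ... *)
Definition young (a : seq nat) : {set 'S_n} :=
  [set s : 'S_n | [forall i, reshape_index a (s i) == reshape_index a i]].

Lemma young_group_set a : group_set (young a).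
Proof.
apply/group_setP; split=> [|s t].
  by rewrite inE; apply/forallP=> i; rewrite perm1.
rewrite !inE => /forallP hs /forallP ht; apply/forallP=> i.
by rewrite permM (eqP (ht _)).
Qed.
Canonical young_group a := Group (young_group_set a).

(* In MathComp, s * t is s followed by t. With the opposite convention the same
   construction yields the inverse cosets, which have the same lengths. *)
Definition double_cosets (b a : seq nat) : {set {set 'S_n}} :=
  [set young b :* w * young a | w : 'S_n].

Definition coset_length (c : {set 'S_n}) : nat :=
  coxeter_length [arg min_(w < repr c in c) coxeter_length w].

End SymmetricGroup.

(* The value of (h_b, h_a), before extension to k *)
Definition hform (b a : seq nat) : int :=
  if sumn b == sumn a then
    (\sum_(c in double_cosets (sumn a) b a) (-1) ^+ coset_length c)%R
  else 0%R.

Section HformSym.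
Variable n : nat.
Local Open Scope group_scope.

Lemma simple_refls_inv : (simple_refls n)^-1 = simple_refls n.
Proof.
have sub : simple_refls n \subset (simple_refls n)^-1.
  apply/subsetP=> s ss; rewrite mem_invg; case/imsetP: (ss) => p _ sE.
  by rewrite sE tpermV -sE.
by apply/eqP; rewrite eq_sym eqEsubset sub -invSg invgK.
Qed.

Lemma coxeter_lengthV (w : 'S_n) : coxeter_length w^-1 = coxeter_length w.
Proof.
suff le (v : 'S_n) : (coxeter_length v^-1 <= coxeter_length v)%N.
  by apply/eqP; rewrite eqn_leq le -{1}[w]invgK le.
rewrite /coxeter_length; case: ex_minnP => m _ minm.
case: ex_minnP => k kv _; apply: minm.
by rewrite -mem_invg -expgVn simple_refls_inv.
Qed.

Lemma coset_lengthV (c : {set 'S_n}) :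
  c != set0 -> coset_length c^-1 = coset_length c.
Proof.
have le (d : {set 'S_n}) : d != set0 -> (coset_length d^-1 <= coset_length d)%N.
  case/set0Pn=> x dx; rewrite /coset_length.
  have V : x^-1 \in d^-1 by rewrite mem_invg invgK.
  case: arg_minnP => [|v _ minv]; first exact: mem_repr V.
  case: arg_minnP => [|u du _]; first exact: mem_repr dx.
  by rewrite -(coxeter_lengthV u) minv // mem_invg invgK.
move=> c0; apply/eqP; rewrite eqn_leq le // -{1}[c]invgK le //.
by case/set0Pn: c0 => x cx; apply/set0Pn; exists x^-1; rewrite mem_invg invgK.
Qed.

Lemma double_cosets_inv a b (c : {set 'S_n}) :
  (c^-1 \in double_cosets n a b) = (c \in double_cosets n b a).
Proof.
suff imp a' b' (d : {set 'S_n}) :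
    d \in double_cosets n b' a' -> d^-1 \in double_cosets n a' b'.
  by apply/idP/idP => /imp //; rewrite invgK.
case/imsetP=> w _ ->; apply/imsetP; exists w^-1 => //.
by rewrite !invMg !invGid invg_set1 mulgA.
Qed.

Lemma double_coset_neq0 a b (c : {set 'S_n}) :
  c \in double_cosets n b a -> c != set0.
Proof.
case/imsetP=> w _ ->; apply/set0Pn; exists (w * 1).
by rewrite mem_mulg ?group1 // rcoset_refl.
Qed.

End HformSym.

Lemma hformC a b : hform a b = hform b a.
Proof.
rewrite /hform eq_sym; case: eqP => // ->.
rewrite (reindex_inj (@invg_inj _)) /=; apply: eq_big => c.
  exact: double_cosets_inv.
by rewrite double_cosets_inv => /double_coset_neq0 /coset_lengthV ->.
Qed.

Section OddSym.
Variable k : comNzRingType.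
Local Open Scope ring_scope.

Local Notation free_sym := {malg k[{fmonom nat}]}.

(* The free generators are indexed by nat: that of index i is h_{i+1}. *)
Definition hgen (m : nat) : free_sym := if m is i.+1 then << fmu i >> else 1.

Definition hprod (a : seq nat) : free_sym := \prod_(x <- a) hgen x.

Definition fcomp (u : {fmonom nat}) : seq nat := [seq i.+1 | i <- u].

Definition form (f g : free_sym) : k :=
  \sum_(u <- msupp f) \sum_(v <- msupp g)
    f@_u * g@_v * (hform (fcomp u) (fcomp v))%:~R.

Lemma formEw (d e : {fset {fmonom nat}}) (f g : free_sym) :
  (msupp f `<=` d)%fset -> (msupp g `<=` e)%fset ->
  form f g = \sum_(u <- d) \sum_(v <- e)
    f@_u * g@_v * (hform (fcomp u) (fcomp v))%:~R.
Proof.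
move=> fd ge; rewrite /form (big_fset_incl _ fd) => [|u _ /mcoeff_outdom fu].
  apply: eq_bigr => u _; rewrite (big_fset_incl _ ge) // => v _ /mcoeff_outdom.
  by move=> ->; rewrite mulr0 mul0r.
by apply: big1 => v _; rewrite fu !mul0r.
Qed.

Lemma formC f g : form f g = form g f.
Proof.
rewrite /form exchange_big /=; apply: eq_bigr => v _; apply: eq_bigr => u _.
by rewrite hformC mulrC [f@_u * _]mulrC mulrC.
Qed.

Lemma formDl f f' g : form (f + f') g = form f g + form f' g.
Proof.
pose d := (msupp f `|` msupp f')%fset.
rewrite (formEw (msuppD_le f f') (fsubset_refl (msupp g))).
rewrite (@formEw d (msupp g) f g) ?fsubsetUl ?fsubset_refl //.
rewrite (@formEw d (msupp g) f' g) ?fsubsetUr ?fsubset_refl //.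
rewrite -big_split; apply: eq_bigr => u _; rewrite -big_split.
by apply: eq_bigr => v _; rewrite mcoeffD !mulrDl.
Qed.

Lemma formZl c f g : form (c *: f) g = c * form f g.
Proof.
rewrite (formEw (msuppZ_le c f) (fsubset_refl (msupp g))) /form mulr_sumr.
apply: eq_bigr => u _; rewrite mulr_sumr; apply: eq_bigr => v _.
by rewrite mcoeffZ !mulrA.
Qed.

Lemma formBl f f' g : form (f - f') g = form f g - form f' g.
Proof. by rewrite formDl -scaleN1r formZl mulN1r. Qed.

Lemma formBr f g g' : form f (g - g') = form f g - form f g'.
Proof. by rewrite ![form f _]formC formBl. Qed.

Lemma hprod_mono (a : seq nat) : 0%N \notin a ->
  exists2 u : {fmonom nat}, fcomp u = a & hprod a = << u >>.
Proof.
rewrite /hprod; elim: a => [|[|x] a IH] //= na.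
  by exists (fmone nat); rewrite ?big_nil // /fcomp fmoneE.
have {IH} [u ua E] := IH na; exists (fmmul (fmu x) u).
  by rewrite /fcomp fmmulE fmuE /= -ua.
by rewrite big_cons E /= malgM_def fgmulUU mulr1.
Qed.

Lemma form_hprod (b a : seq nat) : 0%N \notin b -> 0%N \notin a ->
  form (hprod b) (hprod a) = (hform b a)%:~R.
Proof.
move=> /hprod_mono[u <- ->] /hprod_mono[v <- ->].
by rewrite /form !msuppU1 !big_seq_fset1 !mcoeffUU !mul1r.
Qed.

Definition radical : {pred free_sym} :=
  [pred f | `[< forall g, form f g = 0 >]].

Lemma radicalP f : reflect (forall g, form f g = 0) (f \in radical).
Proof. exact: asboolP. Qed.

Lemma radical_zmod_closed : zmod_closed radical.
Proof.
split=> [|f f' /radicalP fr /radicalP fr']; apply/radicalP => g.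
  by rewrite -(scale0r 0) formZl mul0r.
by rewrite formBl fr fr' subrr.
Qed.

HB.instance Definition _ := GRing.isZmodClosed.Build free_sym radical
  radical_zmod_closed.

(* Only the graded module structure and the form of the quotient are set up;
   h_mu is the class of the product hprod mu taken in the free algebra. *)
Definition odd_sym := @Quotient.quot free_sym radical.

HB.instance Definition _ := GRing.Zmodule.on odd_sym.
HB.instance Definition _ := EqQuotient.on odd_sym.

Local Open Scope quotient_scope.
Definition odd_repr (x : odd_sym) : free_sym := generic_quotient.repr x.

Definition odd_pi (f : free_sym) : odd_sym := \pi f.

Lemma odd_reprK : cancel odd_repr odd_pi.
Proof. exact: reprK. Qed.

Lemma odd_pi_eqP f g : reflect (odd_pi f = odd_pi g) (f - g \in radical).
Proof. by rewrite Quotient.idealrBE; exact: eqP. Qed.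

Lemma odd_piD : {morph odd_pi : f g / f + g}.
Proof. exact: Quotient.pi_add. Qed.

Definition odd_scale (c : k) (x : odd_sym) : odd_sym := odd_pi (c *: odd_repr x).

Lemma odd_scale_pi c f : odd_scale c (odd_pi f) = odd_pi (c *: f).
Proof.
apply/odd_pi_eqP/radicalP => g; rewrite -scalerBr formZl.
have /odd_pi_eqP/radicalP -> : odd_pi (odd_repr (odd_pi f)) = odd_pi f by rewrite odd_reprK.
by rewrite mulr0.
Qed.

Lemma odd_scaleA a b x : odd_scale a (odd_scale b x) = odd_scale (a * b) x.
Proof.
by rewrite -[x]odd_reprK [odd_scale b _]odd_scale_pi !odd_scale_pi scalerA.
Qed.

Lemma odd_scale1 : left_id 1 odd_scale.
Proof. by move=> x; rewrite -{1}[x]odd_reprK odd_scale_pi scale1r odd_reprK. Qed.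

Lemma odd_scaleDr : right_distributive odd_scale +%R.
Proof.
move=> a x y; rewrite -[x]odd_reprK -[y]odd_reprK -odd_piD.
by rewrite !odd_scale_pi scalerDr odd_piD.
Qed.

Lemma odd_scaleDl x : {morph odd_scale^~ x : a b / a + b}.
Proof. by move=> a b; rewrite -[x]odd_reprK !odd_scale_pi scalerDl odd_piD. Qed.

HB.instance Definition _ := GRing.Zmodule_isLmodule.Build k odd_sym
  odd_scaleA odd_scale1 odd_scaleDr odd_scaleDl.

Definition odd_form (x y : odd_sym) : k := form (odd_repr x) (odd_repr y).

Lemma odd_form_pi f g : odd_form (odd_pi f) (odd_pi g) = form f g.
Proof.
have E f' : odd_repr (odd_pi f') - f' \in radical by apply/odd_pi_eqP; rewrite odd_reprK.
apply/eqP; rewrite -subr_eq0; apply/eqP.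
have -> : odd_form (odd_pi f) (odd_pi g) - form f g =
    form (odd_repr (odd_pi f) - f) (odd_repr (odd_pi g)) + form f (odd_repr (odd_pi g) - g).
  by rewrite formBl formBr addrA subrK.
by rewrite (radicalP _ (E f)) formC (radicalP _ (E g)) addr0.
Qed.

Definition homogeneous (n : nat) (f : free_sym) : Prop :=
  forall u, u \in msupp f -> sumn (fcomp u) = n.

Definition odd_graded (n : nat) (x : odd_sym) : Prop :=
  exists2 f, homogeneous n f & x = odd_pi f.

Definition is_odd_schur (n : nat) (s : {ffun intpart n -> odd_sym}) : Prop :=
  (forall la, odd_graded n (s la)) /\
  (forall mu : intpart n,
     odd_pi (hprod mu) = \sum_(la : intpart n) (odd_kostka la mu)%:~R *: s la).

(* The system in is_odd_schur is unitriangular for the dominance order, hence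
   has exactly one solution, and xget picks it. *)
Definition odd_schur (n : nat) : {ffun intpart n -> odd_sym} :=
  xget [ffun=> 0] [set s | is_odd_schur s]%classic.

End OddSym.

(* Main.v *)
(* A semistandard tableau is a chain of partitions in which each step adds a
   horizontal strip, and the sign of the tableau is the product over the steps of
   (-1)^(strip_inv r l); so a signed sum over tableaux is obtained by iterating an
   operator that adds strips.  The theorem amounts to the Cauchy identity
     (h_mu, h_nu) = sum_la (-1)^n(la) K_la,mu K_la,nu,   n(la) = sum_i i la_i,
   because n(la) is binom(la^T, 2) and the odd Kostka matrix is unitriangular.
   Double cosets correspond to matrices with margins mu and nu, with length the
   number of inversions of the matrix.  Both sides of the identity satisfy the
   same recursion on the last part of mu: on the side of partitions it follows
   from a commutation rule between adding strips and the dual operator.  That rule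
   is sign-bijective, by Fomin's local rule for RSK: for l and r fixed, the k
   containing both by horizontal strips correspond to pairs of an integer j and an
   s contained in both by horizontal strips, through
     k_0 = max(l_0, r_0) + j,  k_(i+1) = max(l_(i+1), r_(i+1)) + min(l_i, r_i) - s_i,
   and the signs match since
     n(k) + n(l) + n(r) + n(s) + inv(l,k) + inv(r,k) + inv(s,l) + inv(s,r)
       = (|l| - |s|) (|r| - |s|)  mod 2,  where inv is strip_inv. *)

Require Import Defs.
From mathcomp Require Import all_boot all_order all_algebra.
From mathcomp Require Import all_fingroup finmap monalg zify ring.
From mathcomp Require classical_sets.

Set Implicit Arguments.
Unset Strict Implicit.
Unset Printing Implicit Defensive.

Import GRing.Theory.

Local Notation sgn e := ((-1) ^+ e%N : int)%R.

(** * Horizontal strips and the local rule *)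

(** Reindexing for duplicate-free lists; [f] and [g] have to be mutually inverse only on the terms
    selected by [P] and [Q]. *)
Lemma big_seq_bij (V : nmodType) (I J : eqType) (r : seq I) (s : seq J)
    (P : pred I) (Q : pred J) (f : I -> J) (g : J -> I) (F : I -> V) (G : J -> V) :
  uniq r -> uniq s ->
  (forall x, x \in r -> P x -> [/\ f x \in s, Q (f x), g (f x) = x & F x = G (f x)]) ->
  (forall y, y \in s -> Q y -> [/\ g y \in r, P (g y) & f (g y) = y]) ->
  (\sum_(x <- r | P x) F x = \sum_(y <- s | Q y) G y)%R.
Proof.
move=> ur us fP gP; rewrite -big_filter -[RHS]big_filter.
have E : perm_eq (map f (filter P r)) (filter Q s).
  apply: uniq_perm; rewrite ?filter_uniq //.
    rewrite map_inj_in_uniq ?filter_uniq // => x x'.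
    rewrite !mem_filter => /andP[Px rx] /andP[Px' rx'] /(congr1 g).
    by have [_ _ -> _] := fP _ rx Px; have [_ _ -> _] := fP _ rx' Px'.
  move=> y; rewrite mem_filter; apply/mapP/andP => [[x]|[Qy sy]].
    by rewrite mem_filter => /andP[Px rx] ->; have [] := fP _ rx Px.
  have [rg Pg <-] := gP _ sy Qy; exists (g y) => //.
  by rewrite mem_filter Pg.
rewrite -(perm_big _ E) big_map [LHS]big_seq [RHS]big_seq.
apply: eq_bigr => x; rewrite mem_filter => /andP[Px rx].
by have [] := fP _ rx Px.
Qed.

(** Partitions as plain sequences, so that their size can be an expression such as [sumn l - b]
    without transport between the types [intpart n]. *)
Definition parts (p : nat) : seq (seq nat) := [seq val x | x <- enum {: intpart p}].

Lemma mem_parts p s : (s \in parts p) = is_part s && (sumn s == p).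
Proof.
apply/mapP/idP => [[x _ ->]|H]; first exact: (valP x).
by exists (IntPart H); rewrite ?mem_enum.
Qed.

Lemma parts_uniq p : uniq (parts p).
Proof. by rewrite map_inj_uniq ?enum_uniq //; apply: val_inj. Qed.

Lemma big_parts (V : nmodType) p (F : seq nat -> V) :
  (\sum_(s <- parts p) F s = \sum_(x : intpart p) F x)%R.
Proof. by rewrite big_map big_enum. Qed.

(** Turns a non-increasing function into a partition; cutting at the first zero keeps zero parts out
    of the sequence. *)
Fixpoint mkpart (f : nat -> nat) (N : nat) : seq nat :=
  if N is N'.+1 then
    if f 0 == 0 then [::] else f 0 :: mkpart (f \o succn) N'
  else [::].

Lemma nonincreasing_le (f : nat -> nat) : (forall i, f i.+1 <= f i)%N ->
  forall i j, (i <= j)%N -> (f j <= f i)%N.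
Proof.
move=> df i j /subnKC <-; elim: (j - i)%N => [|d IH]; first by rewrite addn0.
by rewrite addnS (leq_trans (df _)).
Qed.

Lemma nth_mkpart f N : (forall i, f i.+1 <= f i)%N -> f N = 0 ->
  forall i, nth 0 (mkpart f N) i = f i.
Proof.
elim: N f => [|N IH] f df fN i /=.
  rewrite nth_nil; have := nonincreasing_le df (leq0n i).
  by rewrite fN leqn0 => /eqP.
case: eqP => [f0|_].
  rewrite nth_nil; have := nonincreasing_le df (leq0n i).
  by rewrite f0 leqn0 => /eqP.
by case: i => //= i; rewrite IH //= => j; apply: df.
Qed.

Lemma is_part_nthS s i : is_part s -> (nth 0 s i.+1 <= nth 0 s i)%N.
Proof.
case/andP => /(sortedP 0) ss _; have [lt|le] := ltnP i.+1 (size s).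
  exact: ss.
by rewrite [nth 0 s i.+1]nth_default.
Qed.

Lemma is_part_cons x s : is_part (x :: s) = [&& (0 < x)%N, (head 0 s <= x)%N & is_part s].
Proof.
rewrite /is_part /= inE negb_or eq_sym -lt0n.
case: s => [|y s] /=; first by rewrite andbT.
by case: (0 < x)%N; case: (y <= x)%N; rewrite /= ?andbF ?andbT.
Qed.

Lemma mkpart_is_part f N : (forall i, f i.+1 <= f i)%N -> is_part (mkpart f N).
Proof.
elim: N f => [|N IH] f df //=; case: eqP => // /eqP f0.
rewrite is_part_cons lt0n f0 IH ?andbT => [|i]; last exact: df.
by case: N {IH} => //= N; case: eqP => //= _.
Qed.

Lemma is_part_inj s t : is_part s -> is_part t ->
  (forall i, nth 0 s i = nth 0 t i)%N -> s = t.
Proof.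
elim: s t => [|x s IH] [|y t] //.
- by rewrite is_part_cons => _ /and3P[y0 _ _] /(_ 0) /= E; rewrite -E in y0.
- by rewrite is_part_cons => /and3P[y0 _ _] _ /(_ 0) /= E; rewrite E in y0.
rewrite !is_part_cons => /and3P[_ _ ps] /and3P[_ _ pt] E.
by have /= -> := E 0; congr (_ :: _); apply: IH => // i; apply: (E i.+1).
Qed.

Lemma sumn_nth s N : (size s <= N) -> sumn s = (\sum_(i < N) nth 0 s i)%N.
Proof.
elim: s N => [|x s IH] N /=; first by rewrite big1 // => i _; rewrite nth_nil.
by case: N => // N le; rewrite big_ord_recl /= (IH N).
Qed.

Lemma size_part s : is_part s -> (size s <= sumn s)%N.
Proof. by case/andP => _; apply: leq_size_sumn. Qed.

(* The skew shape l / r is a horizontal strip. *)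
Definition strip (r l : seq nat) : bool :=
  all (fun i => nth 0 l i.+1 <= nth 0 r i <= nth 0 l i)%N (iota 0 (size r + size l)).

Lemma stripP r l :
  reflect (forall i, nth 0 l i.+1 <= nth 0 r i <= nth 0 l i)%N (strip r l).
Proof.
apply: (iffP allP) => [H i|H i _]; last exact: H.
have [lt|le] := ltnP i (size r + size l); first by apply: H; rewrite mem_iota.
by rewrite !nth_default //; lia.
Qed.

Lemma strip_sumn r l : strip r l -> (sumn r <= sumn l)%N.
Proof.
move=> /stripP H; rewrite (@sumn_nth r (size r + size l)) ?leq_addr //.
rewrite (@sumn_nth l (size r + size l)) ?leq_addl //.
by apply: leq_sum => i _; case/andP: (H i).
Qed.

(** * The local rule as a bijection *)

Section LocalRule.
Variables (l r : seq nat) (j : nat).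
Hypotheses (pl : is_part l) (pr : is_part r).
Local Notation L := (nth 0 l).
Local Notation R := (nth 0 r).

Definition up_fun (s : seq nat) (i : nat) : nat :=
  if i is i'.+1 then maxn (L i) (R i) + minn (L i') (R i') - nth 0 s i'
  else maxn (L 0) (R 0) + j.

(** Solves the equation of [up_fun] for s. For strips k_(i+1) <= min(l_i, r_i), so the truncated
    subtraction is exact; k_0 is carried by [j] alone. *)
Definition dn_fun (k : seq nat) (i : nat) : nat :=
  maxn (L i.+1) (R i.+1) + minn (L i) (R i) - nth 0 k i.+1.

(** The successor is there because row i+1 of [up_fun] still involves row i of [l] and [r]. *)
Local Notation N := ((size l + size r).+1).
Definition up_part s := mkpart (up_fun s) N.
Definition dn_part k := mkpart (dn_fun k) N.

Let LR0 i : (size l + size r <= i)%N -> L i = 0 /\ R i = 0.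
Proof. by move=> le; rewrite !nth_default //; lia. Qed.

Lemma up_funS s i : strip s l -> strip s r -> (up_fun s i.+1 <= up_fun s i)%N.
Proof.
move=> /stripP sl /stripP sr; have := sl i; have := sr i.
have := is_part_nthS i pl; have := is_part_nthS i pr.
case: i => [|i] /=; first by lia.
by have := sl i; have := sr i; lia.
Qed.

Lemma dn_funS k i : strip l k -> strip r k -> (dn_fun k i.+1 <= dn_fun k i)%N.
Proof.
move=> /stripP lk /stripP rk; rewrite /dn_fun.
have := lk i; have := rk i; have := lk i.+2; have := rk i.+2.
have := is_part_nthS i pl; have := is_part_nthS i pr.
have := is_part_nthS i.+1 pl; have := is_part_nthS i.+1 pr; lia.
Qed.

Lemma nth_up s : strip s l -> strip s r -> forall i, nth 0 (up_part s) i = up_fun s i.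
Proof.
move=> sl sr; apply: nth_mkpart => [i|/=]; first exact: up_funS.
have [-> ->] := LR0 (leqnn _).
by have [-> ->] := @LR0 (size l + size r).+1 (leqnSn _).
Qed.

Lemma nth_dn k : strip l k -> strip r k -> forall i, nth 0 (dn_part k) i = dn_fun k i.
Proof.
move=> sl sr; apply: nth_mkpart => [i|]; first exact: dn_funS.
rewrite /dn_fun; have [-> ->] := @LR0 N (leqnSn _).
by have [|-> ->] := @LR0 N.+1; first lia.
Qed.

(** In each row max(l_i, r_i) + min(l_i, r_i) = l_i + r_i, and the minimum of row i enters row i+1
    of [k]; summing over all rows leaves [j] as the only extra term. *)
Lemma sum_up_fun (s k : seq nat) :
    (forall i, nth 0 s i <= minn (L i) (R i))%N ->
    (forall i, nth 0 k i = up_fun s i) ->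
  (sumn k + sumn s = sumn l + sumn r + j)%N.
Proof.
move=> sle kE; pose M := (size l + size r + size s + size k)%N.
rewrite (@sumn_nth k M.+1) ?(@sumn_nth s M.+1) ?(@sumn_nth l M.+1)
  ?(@sumn_nth r M.+1); try (rewrite /M; lia).
rewrite [X in (_ + X)%N]big_ord_recr [X in (_ + X)%N]/=.
rewrite [nth 0 s M]nth_default ?addn0; last by rewrite /M; lia.
have tele (f : nat -> nat) : (\sum_(i < M.+1) f i = f 0 + \sum_(i < M) f i.+1)%N.
  by rewrite big_ord_recl.
rewrite tele kE -addnA -big_split /=.
have -> : (\sum_(i < M) (nth 0 k i.+1 + nth 0 s i) =
   \sum_(i < M) maxn (L i.+1) (R i.+1) + \sum_(i < M) minn (L i) (R i))%N.
  rewrite -big_split; apply: eq_bigr => i _; rewrite kE /=.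
  by have := sle i; lia.
have E : (\sum_(i < M.+1) minn (L i) (R i) = \sum_(i < M) minn (L i) (R i))%N.
  rewrite big_ord_recr /= [L M]nth_default; last by rewrite /M; lia.
  by rewrite min0n addn0.
have := tele (fun i => maxn (L i) (R i)); rewrite -E addnA.
move: (\sum_(i < M) maxn _ _)%N => A.
have -> : (\sum_(i < M.+1) L i + \sum_(i < M.+1) R i =
   \sum_(i < M.+1) maxn (L i) (R i) + \sum_(i < M.+1) minn (L i) (R i))%N.
  by rewrite -!big_split; apply: eq_bigr => i _ /=; lia.
by lia.
Qed.

(* Fomin's local rule of the growth diagram version of RSK. *)
Lemma local_rule (V : nmodType) (F G : seq nat -> V) P S :
  (P + S = sumn l + sumn r + j)%N ->
  (forall s k, s \in parts S -> k \in parts P -> strip s l -> strip s r ->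
     strip l k -> strip r k -> (forall i, nth 0 k i = up_fun s i) -> F k = G s) ->
  (\sum_(k <- parts P | [&& strip l k, strip r k & nth 0 k 0 == maxn (L 0) (R 0) + j]%N)
    F k = \sum_(s <- parts S | strip s l && strip s r) G s)%R.
Proof.
move=> PS FG.
have UP s : is_part s -> strip s l -> strip s r ->
    [/\ is_part (up_part s), strip l (up_part s), strip r (up_part s)
      & (sumn (up_part s) + sumn s = sumn l + sumn r + j)%N].
  move=> ps sl sr; have nU := nth_up sl sr.
  have slr i : (maxn (L i.+1) (R i.+1) <= nth 0 s i <= minn (L i) (R i))%N.
    by have /stripP/(_ i) := sl; have /stripP/(_ i) := sr; lia.
  have LS i := is_part_nthS i pl; have RS i := is_part_nthS i pr.
  split; first by apply: mkpart_is_part => i; exact: up_funS.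
  - apply/stripP=> i; rewrite !nU; case: i => [|i] /=.
      by have := slr 0; lia.
    by have := slr i; have := slr i.+1; lia.
  - apply/stripP=> i; rewrite !nU; case: i => [|i] /=.
      by have := slr 0; lia.
    by have := slr i; have := slr i.+1; lia.
  by apply: sum_up_fun nU => i; have := slr i; lia.
(* [dn_part] does not read k_0; the condition on k_0 is what lets [up_fun] recover row 0. *)
have DN k : is_part k -> strip l k -> strip r k -> nth 0 k 0 = (maxn (L 0) (R 0) + j)%N ->
    [/\ is_part (dn_part k), strip (dn_part k) l, strip (dn_part k) r
      & forall i, nth 0 k i = up_fun (dn_part k) i].
  move=> pk lk rk k0; have nD := nth_dn lk rk.
  have klr i : (maxn (L i) (R i) <= nth 0 k i)%N /\ (nth 0 k i.+1 <= minn (L i) (R i))%N.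
    by have /stripP/(_ i) := lk; have /stripP/(_ i) := rk; lia.
  have LS i := is_part_nthS i pl; have RS i := is_part_nthS i pr.
  split; first by apply: mkpart_is_part => i; exact: dn_funS.
  - apply/stripP=> i; rewrite !nD /dn_fun.
    by have := klr i; have := klr i.+1; have := LS i; have := RS i; lia.
  - apply/stripP=> i; rewrite !nD /dn_fun.
    by have := klr i; have := klr i.+1; have := LS i; have := RS i; lia.
  case=> [|i]; rewrite //= nD /dn_fun.
  by have := klr i; have := klr i.+1; have := LS i; have := RS i; lia.
apply: (@big_seq_bij _ _ _ _ _ _ _ dn_part up_part); rewrite ?parts_uniq //.
- move=> k; rewrite mem_parts => /andP[pk /eqP kP] /and3P[lk rk /eqP k0].
  have [pd dl dr kE] := DN k pk lk rk k0.
  have [pu lu ru szu] := UP _ pd dl dr.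
  have uk : up_part (dn_part k) = k.
    by apply: is_part_inj => // i; rewrite nth_up.
  have dS : dn_part k \in parts S.
    by rewrite mem_parts pd /=; move: szu kP PS; rewrite uk; clear; lia.
  split=> //; first by rewrite dl.
  by apply: FG => //; rewrite mem_parts pk kP /=.
- move=> s; rewrite mem_parts => /andP[ps /eqP sS] /andP[sl sr].
  have [pu lu ru szu] := UP _ ps sl sr.
  have u0 : nth 0 (up_part s) 0 = (maxn (L 0) (R 0) + j)%N by rewrite nth_up.
  have [pd dl dr uE] := DN _ pu lu ru u0.
  split; first by rewrite mem_parts pu /=; move: szu sS PS; clear; lia.
    by rewrite lu ru u0 eqxx.
  apply: is_part_inj => // i; have := uE i.+1; rewrite nth_up //=.
  have /stripP/(_ i) := sl; have /stripP/(_ i) := dl.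
  have /stripP/(_ i) := sr; have /stripP/(_ i) := dr.
  by clear; lia.
Qed.

End LocalRule.

(** * The statistics n and inv, and the sign of the local rule *)

Definition nstat (l : seq nat) : nat := \sum_(i < size l) i * nth 0 l i.

(** The inversions created by filling l / r with a new largest letter: rows are read from the bottom
    up, so a new letter in row [i] precedes and exceeds the old letters of all rows [q < i]. *)
Definition strip_inv (r l : seq nat) : nat :=
  \sum_(i < size l) (nth 0 l i - nth 0 r i) * (\sum_(q < i) nth 0 r q).

Lemma big_ord_stable (F : nat -> nat) m N : (m <= N)%N ->
  (forall i, m <= i -> F i = 0) -> \sum_(i < m) F i = \sum_(i < N) F i.
Proof.
move=> /subnKC <- F0; elim: (N - m) => [|d IH]; first by rewrite addn0.
by rewrite addnS big_ord_recr /= -IH F0 ?addn0 // leq_addr.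
Qed.

Lemma nstatE l N : size l <= N -> nstat l = \sum_(i < N) i * nth 0 l i.
Proof.
move=> le; apply: (big_ord_stable (F := fun i => i * nth 0 l i)) => // i li.
by rewrite nth_default // muln0.
Qed.

Lemma strip_invE r l N : size l <= N ->
  strip_inv r l = \sum_(i < N) (nth 0 l i - nth 0 r i) * (\sum_(q < i) nth 0 r q).
Proof.
move=> le; apply: (big_ord_stable (F := fun i =>
  (nth 0 l i - nth 0 r i) * (\sum_(q < i) nth 0 r q))) => // i li.
by rewrite nth_default // sub0n.
Qed.

(** The inductive step of [local_sign_partial] when row [N] is added: [L], [R], [S] stand for the
    sums of the earlier rows, [m0] and [s0] for the minimum and the part of s in the row before.
    Modulo 2 this is a finite check. *)
Lemma local_sign_step E N L R S m0 s0 l r s k :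
    s0 <= m0 -> s <= minn l r -> maxn l r <= k -> k = maxn l r + m0 - s0 ->
    odd (E + (N + (L + R)) * (m0 + s0)) = odd ((L + S) * (R + S)) ->
  odd (E + N * (k + l + r + s) + (k - r) * R + (l - s) * S + (k - l) * L
     + (r - s) * S + (N.+1 + (L + l + (R + r))) * (minn l r + s))
  = odd ((L + l + (S + s)) * (R + r + (S + s))).
Proof.
rewrite leq_min geq_max => s0m /andP[sl sr] /andP[lk rk] kE.
rewrite !(oddD, oddM) /= !oddB // kE !oddB ?(leq_trans s0m) ?leq_addl // !oddD.
(* Since max + min = l + r, only the parity of the minimum remains, and it is that of [l] or of
   [r]. *)
have -> : odd (maxn l r) = odd l (+) odd r (+) odd (minn l r).
  by case: leqP; rewrite ?addbK // addbC addbA addbb.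
have : odd (minn l r) = odd l \/ odd (minn l r) = odd r.
  by case: leqP; [left|right].
clear; move: (odd E) (odd N) (odd L) (odd R) (odd S) (odd m0) (odd s0).
move: (odd (minn l r)) (odd l) (odd r) (odd s).
by move=> m l1 r1 s1 E1 N1 L1 R1 S1 m1 s2 [] ->; move: l1 r1 s1 E1 N1 L1 R1 S1 m1 s2; do 10 case.
Qed.

(* The last summand on the left is a boundary term, which vanishes for large N. *)
Lemma local_sign_partial (l r s k : nat -> nat) N :
  (forall i, s i <= minn (l i) (r i)) -> (forall i, maxn (l i) (r i) <= k i) ->
  (forall i, k i.+1 = maxn (l i.+1) (r i.+1) + minn (l i) (r i) - s i) ->
  odd (\sum_(i < N.+1) i * (k i + l i + r i + s i)
     + \sum_(i < N.+1) (k i - r i) * (\sum_(q < i) r q)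
     + \sum_(i < N.+1) (l i - s i) * (\sum_(q < i) s q)
     + \sum_(i < N.+1) (k i - l i) * (\sum_(q < i) l q)
     + \sum_(i < N.+1) (r i - s i) * (\sum_(q < i) s q)
     + (N.+1 + \sum_(i < N.+1) (l i + r i)) * (minn (l N) (r N) + s N))
  = odd ((\sum_(i < N.+1) l i + \sum_(i < N.+1) s i)
       * (\sum_(i < N.+1) r i + \sum_(i < N.+1) s i)).
Proof.
move=> sle kge kS; elim: N => [|N IH].
  rewrite !big_ord1 /= !big_ord0 /= !muln0 !addn0 !mul0n !add0n.
  rewrite !oddM !oddD /=; clear.
  by case: leqP => _; case: (odd (l 0)); case: (odd (r 0)); case: (odd (s 0)).
have := local_sign_step (sle N) (sle N.+1) (kge N.+1) (kS N).
have := IH; rewrite big_split /= => /[swap] /[apply].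
do 9 rewrite (big_ord_recr N.+1) /=.
rewrite !big_split /= => <-; congr odd; lia.
Qed.

(** The sign identity arranged for [dual_strip_cons]: the left side is the exponent of a term over
    [k], the right side that of the corresponding term over [s]. *)
Lemma local_sign l r s k j : is_part l -> is_part r -> is_part s ->
    strip s l -> strip s r -> strip l k -> strip r k ->
    (forall i, nth 0 k i = up_fun l r j s i) ->
  odd (nstat k + nstat l + strip_inv l k + strip_inv r k) =
  odd ((sumn r - sumn s) * (sumn l - sumn s) + strip_inv s l
       + (nstat r + nstat s + strip_inv s r)).
Proof.
move=> pl pr ps sl sr lk rk kE.
(* A row beyond all four partitions, where the boundary term of [local_sign_partial] vanishes. *)
pose N := size l + size r + size s + size k.
have := @local_sign_partial (nth 0 l) (nth 0 r) (nth 0 s) (nth 0 k) N.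
have -> : nth 0 l N = 0 by rewrite nth_default // /N; lia.
have -> : nth 0 s N = 0 by rewrite nth_default // /N; lia.
rewrite min0n addn0 muln0 addn0.
under eq_bigr do rewrite !mulnDr.
rewrite !big_split /= -!nstatE -?strip_invE -?sumn_nth; try by rewrite /N; clear; lia.
move=> E; have {E} : odd (nstat k + nstat l + nstat r + nstat s + strip_inv r k
    + strip_inv s l + strip_inv l k + strip_inv s r)
    = odd ((sumn l + sumn s) * (sumn r + sumn s)).
  apply: E => // i.
  - by have /stripP/(_ i) := sl; have /stripP/(_ i) := sr; clear; lia.
  - by have /stripP/(_ i) := lk; have /stripP/(_ i) := rk; clear; lia.
rewrite !(oddD, oddM) !oddB ?strip_sumn //.
move: (odd (nstat k)) (odd (nstat l)) (odd (nstat r)) (odd (nstat s)) => [] [] [] [];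
move: (odd (strip_inv r k)) (odd (strip_inv s l)) (odd (strip_inv l k))
  (odd (strip_inv s r)) => [] [] [] [];
by do 3 case: (odd (sumn _)).
Qed.

(** The first row of a strip contains at most all of its boxes; this will bound the parameter j of
    the local rule. *)
Lemma strip_head l k : strip l k -> nth 0 k 0 + sumn l <= nth 0 l 0 + sumn k.
Proof.
move=> /stripP lk; pose N := size l + size k.
rewrite (@sumn_nth l N.+1) ?(@sumn_nth k N.+1); try (rewrite /N; lia).
rewrite !big_ord_recl /= addnCA leq_add2l leq_add2l.
by apply: leq_sum => i _; case/andP: (lk i.+1).
Qed.

(** * The odd Cauchy identity *)

Section StripSums.
Local Open Scope ring_scope.

Lemma eq_sgn m n : odd m = odd n -> sgn m = sgn n.
Proof. by rewrite -signr_odd => ->; rewrite signr_odd. Qed.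

(* The list [nu] is read backwards: its head is the length of the last strip. *)
Fixpoint strip_sum (nu l : seq nat) : int :=
  if nu is b :: nu' then
    \sum_(r <- parts (sumn l - b)%N | (b <= sumn l)%N && strip r l)
      sgn (strip_inv r l) * strip_sum nu' r
  else (l == [::])%:R.

(** The adjoint of adding a strip of size [a], for the form in which partitions are orthogonal and
    [l] has square (-1)^n(l). *)
Definition dual_strip (a : nat) (Y : seq nat -> int) (l : seq nat) : int :=
  \sum_(k <- parts (sumn l + a)%N | strip l k)
    sgn (nstat k + nstat l + strip_inv l k) * Y k.

(** Row i+1 of [k] is at most row i of [l], so only the first row of [k] is left over. *)
Lemma strip_tail l k : strip l k -> (sumn k <= nth 0 k 0 + sumn l)%N.
Proof.
move=> /stripP lk; pose N := (size l + size k)%N.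
rewrite (@sumn_nth k N.+1) ?(@sumn_nth l N); try (rewrite /N; lia).
rewrite big_ord_recl leq_add2l.
by apply: leq_sum => i _; case/andP: (lk i).
Qed.

(** Sorts the [k] by j = k_0 - max(l_0, r_0), the parameter of the local rule; [strip_head] for [l]
    and for [r] bounds it by min(a, b). *)
Lemma sum_split_head l r b k_size (F : seq nat -> int) a :
    (sumn r + b = k_size)%N -> (sumn l + a = k_size)%N ->
  \sum_(k <- parts k_size | strip l k && strip r k) F k =
  \sum_(j <- iota 0 (minn a b).+1) \sum_(k <- parts k_size |
    [&& strip l k, strip r k & nth 0%N k 0 == (maxn (nth 0%N l 0) (nth 0%N r 0) + j)%N]) F k.
Proof.
move=> rb la.
rewrite [RHS](exchange_big_dep (fun k => strip l k && strip r k)); last first.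
  by move=> j k _ /and3P[-> ->].
rewrite big_seq_cond [RHS]big_seq_cond; apply: eq_bigr => k.
case/andP; rewrite mem_parts => /andP[pk /eqP kE] /andP[lk rk].
have hl := strip_head lk; have hr := strip_head rk.
have /stripP/(_ 0%N)/andP[_ l0] := lk; have /stripP/(_ 0%N)/andP[_ r0] := rk.
set j := (nth 0 k 0 - maxn (nth 0 l 0) (nth 0 r 0))%N.
have jin : j \in iota 0 (minn a b).+1 by rewrite mem_iota /j; lia.
move: (iota 0 _) (iota_uniq 0 (minn a b).+1) jin => js ujs jin.
rewrite [RHS](@big_rem _ _ _ _ _ j) //= {1 2}/j lk rk /= subnKC ?geq_max ?l0 ?r0 //.
rewrite eqxx big1_seq ?addr0 // => i.
by rewrite mem_rem_uniq // !inE => /andP[/eqP ik] /andP[/eqP ij]; rewrite /j; lia.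
Qed.

(** The commutation rule. With U_b for adding a strip of size b and D_a for the adjoint of U_a, it
    reads D_a U_b = sum_j (-1)^((a-j)(b-j)) U_(b-j) D_(a-j). The sign is that of [local_sign], where
    |r| - |s| = a - j and |l| - |s| = b - j. *)
Lemma dual_strip_cons a b nu l : is_part l ->
  dual_strip a (strip_sum (b :: nu)) l =
  \sum_(j <- iota 0 (minn a b).+1) sgn ((a - j) * (b - j)) *
    \sum_(s <- parts (sumn l - (b - j))%N | (b - j <= sumn l)%N && strip s l)
      sgn (strip_inv s l) * dual_strip (a - j) (strip_sum nu) s.
Proof.
move=> pl; have [ble|blt] := leqP b (sumn l + a); last first.
  rewrite /dual_strip [LHS]big1_seq => [|k /andP[_]]; last first.
    rewrite mem_parts => /andP[_ /eqP kE] /=.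
    by rewrite big_pred0 ?mulr0 // => r; rewrite kE leqNgt blt.
  rewrite big1_seq // => j /andP[_]; rewrite mem_iota => jle.
  by rewrite big_pred0 ?mulr0 // => s; case: leqP => //; lia.
set q := (sumn l + a - b)%N.
transitivity (\sum_(r <- parts q) \sum_(k <- parts (sumn l + a)%N | strip l k && strip r k)
   sgn (nstat k + nstat l + strip_inv l k + strip_inv r k) * strip_sum nu r).
  rewrite -(exchange_big_dep xpredT) //= /dual_strip big_seq_cond [RHS]big_seq_cond.
  apply: eq_bigr => k /andP[]; rewrite mem_parts => /andP[_ /eqP ->] _.
  rewrite ble /= mulr_sumr; apply: eq_bigr => r _.
  by rewrite mulrA -exprD.
transitivity (\sum_(j <- iota 0 (minn a b).+1) \sum_(r <- parts q)
   \sum_(s <- parts (sumn l - (b - j))%N | (b - j <= sumn l)%N && strip s l && strip s r)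
   sgn ((a - j) * (b - j) + strip_inv s l + (nstat r + nstat s + strip_inv s r))
     * strip_sum nu r); last first.
  rewrite big_seq [RHS]big_seq; apply: eq_bigr => j; rewrite mem_iota => jle.
  rewrite -(exchange_big_dep xpredT) //= mulr_sumr.
  rewrite big_seq_cond [RHS]big_seq_cond; apply: eq_bigr => s /andP[].
  rewrite mem_parts => /andP[_ /eqP sE] /andP[bj _].
  rewrite /dual_strip !mulr_sumr (_ : (sumn s + (a - j) = q)%N); last by rewrite /q; lia.
  by apply: eq_bigr => r _; rewrite !mulrA -!exprD.
rewrite exchange_big /= big_seq [RHS]big_seq; apply: eq_bigr => r.
rewrite mem_parts => /andP[pr /eqP rE].
rewrite (@sum_split_head l r b _ _ a) //; last by rewrite rE /q; lia.
rewrite big_seq [RHS]big_seq; apply: eq_bigr => j; rewrite mem_iota => jle.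
have [bj|bj] := leqP (b - j) (sumn l); last first.
  (* Here s would have negative size. No [k] exists either, since [strip_tail] forces |k| <= |l| +
     |r| + j. *)
  rewrite [RHS]big_pred0 // big1_seq // => k /andP[/and3P[lk rk /eqP k0]].
  rewrite mem_parts => /andP[_ /eqP kE].
  have : (nth 0 l 0 <= sumn l)%N by case: (l) => //= x t; exact: leq_addr.
  have : (nth 0 r 0 <= sumn r)%N by case: (r) => //= x t; exact: leq_addr.
  by have := strip_tail lk; have := strip_tail rk; rewrite k0; lia.
rewrite (local_rule (S := (sumn l - (b - j))%N) pl pr _
  (G := fun s => sgn ((a - j) * (b - j) + strip_inv s l +
    (nstat r + nstat s + strip_inv s r)) * strip_sum nu r)) //.
  by rewrite rE /q; lia.
move=> s k; rewrite !mem_parts => /andP[ps /eqP sE] /andP[pk /eqP kS] sl sr lk rk kE.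
congr (_ * _); apply: eq_sgn.
rewrite (local_sign pl pr ps sl sr lk rk kE).
have -> : (sumn r - sumn s = a - j)%N by rewrite rE sE /q; lia.
by have -> : (sumn l - sumn s = b - j)%N by rewrite sE; lia.
Qed.

End StripSums.

(** * Signed sums over matrices and the Cauchy identity *)

Section OddCauchy.
Local Open Scope ring_scope.

(** The possible first rows of a matrix of naturals: row sum [a], entries bounded by the column sums
    [nu]. *)
Fixpoint bounded_rows (a : nat) (nu : seq nat) : seq (seq nat) :=
  if nu is b :: nu' then
    [seq j :: c | j <- iota 0 (minn a b).+1, c <- bounded_rows (a - j) nu']
  else if a == 0%N then [:: [::]] else [::].

Lemma bounded_rows_cons a b nu : bounded_rows a (b :: nu) =
  [seq j :: c | j <- iota 0 (minn a b).+1, c <- bounded_rows (a - j) nu].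
Proof. by []. Qed.

Definition row_sub (nu c : seq nat) : seq nat := [seq (p.1 - p.2)%N | p <- zip nu c].

(** The sum of c_q d_q' over q' < q, that is, the inversions between a row [c] and a row [d] below
    it. *)
Fixpoint row_inv (c d : seq nat) : nat :=
  match c, d with
  | _ :: c', e :: d' => (sumn c' * e + row_inv c' d')%N
  | _, _ => 0%N
  end.

Lemma mem_bounded_rows a nu c : (c \in bounded_rows a nu) = (sumn c == a) && all2 leq c nu.
Proof.
elim: nu a c => [|b nu IH] a c; last rewrite bounded_rows_cons.
  case: c => [|x c]; case: a => [|a] //=; rewrite ?andbF //.
apply/allpairsPdep/idP => [[j [d [jin din ->]]] /=|].
  move: jin din; rewrite mem_iota IH => jle /andP[/eqP -> ->].
  by rewrite andbT; lia.
case: c => [|j c]; first by rewrite andbF.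
move=> /andP[/eqP jc /andP[jb le]]; rewrite -{}jc; exists j, c; split=> //.
  by rewrite mem_iota /=; lia.
by rewrite IH [all2 _ _ _]le andbT /= addKn.
Qed.

Lemma sumn_row_sub nu c : all2 leq c nu -> (sumn (row_sub nu c) + sumn c = sumn nu)%N.
Proof.
elim: c nu => [|x c IH] [|b nu] //= /andP[xb /IH].
by rewrite /row_sub /=; lia.
Qed.

(** Iterates the commutation rule along [nu]; the chosen values of j form a row [c], and [nu] minus
    [c] remains. *)
Lemma dual_strip_sum a nu l : is_part l ->
  dual_strip a (strip_sum nu) l =
  \sum_(c <- bounded_rows a nu) sgn (row_inv c (row_sub nu c)) * strip_sum (row_sub nu c) l.
Proof.
elim: nu a l => [|b nu IH] a l pl.
  rewrite /dual_strip /=; case: a => [|a] /=.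
    rewrite big_seq1 mul1r addn0; case: l pl => [|x l] pl /=.
      rewrite (big_rem [::]) /=; last by rewrite mem_parts.
      rewrite big1_seq => [|k /andP[_]].
        by rewrite /nstat /strip_inv !big_ord0 addr0.
      rewrite mem_rem_uniq ?parts_uniq // !inE => /andP[/negPf ->].
      by rewrite mulr0.
    rewrite big1_seq // => k /andP[/strip_sumn kl].
    case: eqP kl => [->|]; last by rewrite mulr0.
    by move: pl; rewrite is_part_cons /=; lia.
  rewrite big_nil big1_seq // => k /andP[_].
  rewrite mem_parts => /andP[_ /eqP]; case: k => [|x k] /=; first by lia.
  by rewrite mulr0.
rewrite dual_strip_cons // bounded_rows_cons big_allpairs_dep; apply: eq_bigr => j _.
transitivity (\sum_(c <- bounded_rows (a - j) nu)
   sgn ((a - j) * (b - j) + row_inv c (row_sub nu c)) * strip_sum ((b - j)%N :: row_sub nu c) l).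
  rewrite /= mulr_sumr.
  transitivity (\sum_(s <- parts (sumn l - (b - j)) | (b - j <= sumn l)%N && strip s l)
     \sum_(c <- bounded_rows (a - j) nu) sgn ((a - j) * (b - j) + row_inv c (row_sub nu c)) *
       (sgn (strip_inv s l) * strip_sum (row_sub nu c) s)).
    rewrite big_seq_cond [RHS]big_seq_cond; apply: eq_bigr => s.
    rewrite mem_parts -andbA => /and3P[ps _ _]; rewrite IH // !mulr_sumr.
    by apply: eq_bigr => c _; rewrite exprD -!mulrA; congr (_ * _); rewrite mulrCA.
  by rewrite exchange_big /=; apply: eq_bigr => c _; rewrite mulr_sumr.
(* Since [a - j] is the sum of [c], the exponent (a - j)(b - j) is the contribution of the first
   column to [row_inv]. *)
rewrite big_seq [RHS]big_seq; apply: eq_bigr => c.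
by rewrite mem_bounded_rows => /andP[/eqP <- _].
Qed.

(** A sum over matrices with row sums [mu] and column sums [nu], see [signed_matsE]; each row is
    compared at once with the column sums of all rows below it. *)
Fixpoint signed_mats (mu nu : seq nat) : int :=
  if mu is a :: mu' then
    \sum_(c <- bounded_rows a nu) sgn (row_inv c (row_sub nu c)) * signed_mats mu' (row_sub nu c)
  else (sumn nu == 0%N)%:R.

Lemma strip_sum_nil nu : sumn nu = 0%N -> strip_sum nu [::] = 1.
Proof.
elim: nu => //= b nu IH; case: b => // n0.
rewrite (big_rem [::]) /=; last by rewrite mem_parts.
rewrite big1_seq => [|k /andP[_]]; first by rewrite /strip_inv big_ord0 IH ?mulr1 // addr0.
rewrite mem_rem_uniq ?parts_uniq // !inE mem_parts => /and3P[k0 pk sk].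
by have := size_part pk; rewrite (eqP sk) leqn0 size_eq0 (negPf k0).
Qed.

(** The first entry [a] of the list is moved across the form: adding a strip in one factor becomes
    [dual_strip] on the other, and [dual_strip_sum] expands this over the first rows of matrices. *)
Lemma odd_cauchy mu nu : sumn mu = sumn nu ->
  signed_mats mu nu =
  \sum_(l <- parts (sumn nu)) sgn (nstat l) * (strip_sum mu l * strip_sum nu l).
Proof.
elim: mu nu => [|a mu IH] nu /=.
  move=> /esym nu0; rewrite nu0 eqxx (big_rem [::]) /=; last by rewrite mem_parts.
  rewrite big1_seq => [|k /andP[_]].
    by rewrite /nstat big_ord0 strip_sum_nil // addr0.
  rewrite mem_rem_uniq ?parts_uniq // !inE => /andP[/negPf -> _].
  by rewrite mul0r mulr0.
move=> nuE.
transitivity (\sum_(r <- parts (sumn mu)) sgn (nstat r) *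
    (strip_sum mu r * dual_strip a (strip_sum nu) r)).
  transitivity (\sum_(r <- parts (sumn mu)) \sum_(c <- bounded_rows a nu)
     sgn (row_inv c (row_sub nu c)) * (sgn (nstat r) * (strip_sum mu r * strip_sum (row_sub nu c) r))).
    rewrite exchange_big big_seq [RHS]big_seq; apply: eq_bigr => c.
    rewrite mem_bounded_rows => /andP[/eqP ca cn]; rewrite -mulr_sumr.
    have E : sumn mu = sumn (row_sub nu c) by have := sumn_row_sub cn; lia.
    by rewrite IH // E.
  rewrite big_seq [RHS]big_seq; apply: eq_bigr => r; rewrite mem_parts => /andP[pr _].
  rewrite dual_strip_sum // !mulr_sumr; apply: eq_bigr => c _.
  by rewrite mulrCA; congr (_ * _); rewrite mulrCA.
transitivity (\sum_(r <- parts (sumn mu)) \sum_(l <- parts (sumn nu) | strip r l)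
    sgn (nstat l) * (sgn (strip_inv r l) * strip_sum mu r * strip_sum nu l)).
  rewrite big_seq [RHS]big_seq; apply: eq_bigr => r; rewrite mem_parts => /andP[pr /eqP rE].
  rewrite /dual_strip rE addnC nuE !mulr_sumr; apply: eq_bigr => l _.
  have -> : sgn (nstat l + nstat r + strip_inv r l) =
    sgn (nstat r) * (sgn (nstat l) * sgn (strip_inv r l)).
    by rewrite -!exprD; congr (_ ^+ _); lia.
  (* The sign of [r] comes once from the form and once from [dual_strip], and cancels. *)
  transitivity (sgn (nstat r) ^+ 2 *
    (sgn (nstat l) * (sgn (strip_inv r l) * strip_sum mu r * strip_sum nu l))).
    by ring.
  by rewrite sqrr_sign mul1r.
rewrite (exchange_big_dep xpredT) //= big_seq [RHS]big_seq; apply: eq_bigr => l.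
rewrite mem_parts => /andP[_ /eqP lE]; rewrite lE -nuE leq_addr addKn /=.
by rewrite mulr_suml mulr_sumr.
Qed.

End OddCauchy.

(** * Signed sums over tableaux *)

Fixpoint inv_word (w : seq nat) : nat :=
  if w is x :: w' then count (fun y => y < x) w' + inv_word w' else 0.

Lemma inversionsE w : inversions w = inv_word w.
Proof.
have -> : inversions w = \sum_(i < size w) \sum_(j < size w)
    ((i < j) && (nth 0 w j < nth 0 w i)).
  rewrite /inversions -sum1_card pair_big /= big_mkcond /=.
  by apply: eq_bigr => p _; rewrite inE; case: (_ && _).
elim: w => [|x w IH] /=; first by rewrite big_ord0.
rewrite big_ord_recl /= big_ord_recl /= add0n; congr (_ + _).
  rewrite -sum1_count (big_nth 0) big_mkord [RHS]big_mkcond /=.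
  by apply: eq_bigr => i _; rewrite add0n; case: (_ < _).
by rewrite -IH; apply: eq_bigr => i _; rewrite big_ord_recl.
Qed.

Definition word_inv_between (u v : seq nat) : nat := \sum_(x <- u) count (fun y => y < x) v.

Lemma inv_word_cat u v : inv_word (u ++ v) = inv_word u + inv_word v + word_inv_between u v.
Proof.
rewrite /word_inv_between; elim: u => [|x u IH] /=; first by rewrite big_nil addn0.
by rewrite IH big_cons count_cat; lia.
Qed.

Lemma inv_word_nseq k x : inv_word (nseq k x) = 0.
Proof. by elim: k => //= k ->; rewrite addn0 count_nseq /= ltnn. Qed.

Section ExtendWord.
Variables (m : nat) (R : nat -> seq nat) (k : nat -> nat).
Hypothesis Rm : forall i, all (leq^~ m) (R i).

(** An appended letter is followed by equal letters and by the old letters of the rows above, which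
    are all smaller; no old letter exceeds an appended one. *)
Lemma inv_word_extend N :
  inv_word (flatten (rev (mkseq (fun i => R i ++ nseq (k i) m.+1) N))) =
  inv_word (flatten (rev (mkseq R N))) + \sum_(i < N) k i * (\sum_(q < i) size (R q)).
Proof.
pose E i := R i ++ nseq (k i) m.+1.
have cntE x M : x <= m.+1 -> count (fun y => y < x) (flatten (rev (mkseq E M))) =
    count (fun y => y < x) (flatten (rev (mkseq R M))).
  move=> xm; elim: M => //= M IH; rewrite !mkseqS !rev_rcons /= !count_cat IH.
  by rewrite count_nseq /= ltnNge xm mul0n addn0.
have cntR M : count (fun y => y < m.+1) (flatten (rev (mkseq R M))) = \sum_(q < M) size (R q).
  elim: M => [|M IH]; first by rewrite big_ord0.
  rewrite !mkseqS !rev_rcons /= !count_cat IH big_ord_recr /= addnC; congr (_ + _).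
  by apply/eqP; rewrite -all_count; apply: Rm.
elim: N => [|N IH]; first by rewrite !big_ord0 addn0.
rewrite big_ord_recr !mkseqS !rev_rcons /= !inv_word_cat -/E IH inv_word_nseq.
rewrite /word_inv_between big_cat /= [X in _ + _ + X](_ : _ =
  word_inv_between (R N) (flatten (rev (mkseq R N))) + k N * \sum_(q < N) size (R q)); last first.
  congr (_ + _).
    rewrite big_seq [RHS]big_seq; apply: eq_bigr => x xR.
    by apply: cntE; rewrite ltnW // ltnS; apply: (allP (Rm N)).
  by rewrite big_nseq cntE // cntR iter_addn_0 mulnC.
rewrite [X in _ + 0 + X]big1_seq ?addn0 => [|x /andP[_ xR]].
  by rewrite /word_inv_between -!addnA; congr (_ + (_ + _)); rewrite addnCA.
by rewrite count_nseq /= ltnNge leqW // (allP (Rm N)).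
Qed.
End ExtendWord.

(** * Semistandardness and content, row by row *)

Lemma rows_inj (T T' : seq (seq nat)) : 0 \notin shape T -> 0 \notin shape T' ->
  (forall i, nth [::] T i = nth [::] T' i) -> T = T'.
Proof.
elim: T T' => [|r T IH] [|r' T'] //=.
- by rewrite inE negb_or => _ /andP[r0 _] /(_ 0) /= E; rewrite -E in r0.
- by rewrite inE negb_or => /andP[r0 _] _ /(_ 0) /= E; rewrite E in r0.
rewrite !inE !negb_or => /andP[_ T0] /andP[_ T0'] E.
by have /= -> := E 0; congr (_ :: _); apply: IH => // i; apply: (E i.+1).
Qed.

(** Rows are indexed by all naturals, with empty rows as padding, so that tableaux of different
    heights can be compared. *)
Definition ss_rows (R : nat -> seq nat) : Prop :=
  [/\ forall i, sorted leq (R i), forall i, 0 \notin R i,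
      forall i, size (R i.+1) <= size (R i)
    & forall i j, j < size (R i.+1) -> nth 0 (R i) j < nth 0 (R i.+1) j].

Lemma nth_shape (T : seq (seq nat)) i : nth 0 (shape T) i = size (nth [::] T i).
Proof.
have [lt|le] := ltnP i (size T); first by rewrite (nth_map [::]).
by rewrite !nth_default ?size_map.
Qed.

Lemma semistandardP (T : seq (seq nat)) :
  reflect (0 \notin shape T /\ ss_rows (nth [::] T)) (semistandard T).
Proof.
apply: (iffP and4P) => [[pT T0 sT cT]|[T0 [sR R0 dR cR]]].
  have [_ sh0] := andP pT.
  split=> //; split=> [i|i|i|i j].
  - have [lt|le] := ltnP i (size T); last by rewrite nth_default.
    by apply: (allP sT); apply: mem_nth.
  - have [lt|le] := ltnP i (size T); last by rewrite nth_default.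
    by apply: contra T0 => ?; apply/flattenP; exists (nth [::] T i); rewrite ?mem_nth.
  - by rewrite -!nth_shape; apply: is_part_nthS.
  move=> jlt; have lt : i.+1 < size T.
    by rewrite ltnNge; apply/negP => le; rewrite nth_default in jlt.
  by have /(sortedP [::])/(_ i lt)/allP := cT; apply; rewrite mem_iota.
split.
- rewrite /is_part T0 andbT; apply/(sortedP 0) => i _.
  by rewrite /geq /= !nth_shape.
- apply/negP => /flattenP[r /(nthP [::])[i _ <-]]; exact/negP/R0.
- by apply/allP => r /(nthP [::])[i _ <-].
apply/(sortedP [::]) => i _; apply/allP => j; rewrite mem_iota /=; exact: cR.
Qed.

Fixpoint mkrows (R : nat -> seq nat) (N : nat) : seq (seq nat) :=
  if N is N'.+1 then
    if nilp (R 0) then [::] else R 0 :: mkrows (R \o succn) N'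
  else [::].

Lemma nth_mkrows R N : (forall i, size (R i.+1) <= size (R i)) -> R N = [::] ->
  forall i, nth [::] (mkrows R N) i = R i.
Proof.
elim: N R => [|N IH] R dR RN i /=.
  rewrite nth_nil; apply/esym/nilP; rewrite /nilp -leqn0.
  by have /= := nonincreasing_le (f := size \o R) dR (leq0n i); rewrite RN.
case: ifP => [/nilP R0|_].
  rewrite nth_nil; apply/esym/nilP; rewrite /nilp -leqn0.
  by have /= := nonincreasing_le (f := size \o R) dR (leq0n i); rewrite R0.
by case: i => //= i; rewrite IH // => j; apply: dR.
Qed.

Lemma mkrows_nonempty R N : 0 \notin shape (mkrows R N).
Proof.
elim: N R => //= N IH R; case: ifP => //= R0.
by rewrite inE negb_or IH eq_sym -/(nilp _) R0.
Qed.

Lemma mkrows_semistandard R N : ss_rows R -> R N = [::] -> semistandard (mkrows R N).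
Proof.
move=> sR RN; have [_ _ dR _] := sR; apply/semistandardP; split.
  exact: mkrows_nonempty.
have E := nth_mkrows dR RN; case: sR => s1 s2 s3 s4.
by split=> [i|i|i|i j]; rewrite !E //; apply: s4.
Qed.

Lemma count_flatten_nth (a : pred nat) (T : seq (seq nat)) N : size T <= N ->
  count a (flatten T) = \sum_(i < N) count a (nth [::] T i).
Proof.
move=> le; rewrite count_flatten (@sumn_nth _ N) ?size_map //.
apply: eq_bigr => i _; have [lt|ge] := ltnP i (size T); first by rewrite (nth_map [::]).
by rewrite !nth_default ?size_map.
Qed.

(** [content] stops at the largest entry. As the last part of [mu] is nonzero, this entry is
    [size mu], and the multiplicities determine the list. *)
Lemma contentP (T : seq (seq nat)) mu : 0 \notin mu ->
  reflect (forall x, count_mem x.+1 (flatten T) = nth 0 mu x) (content T == mu).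
Proof.
move=> mu0; apply: (iffP eqP) => [<- x|H]; first exact: count_content.
have lastmu m : size mu = m.+1 -> m.+1 \in flatten T.
  move=> E; rewrite -has_pred1 has_count H lt0n.
  by apply: contra mu0 => /eqP <-; rewrite mem_nth // E.
rewrite /content; suff -> : \max_(x <- flatten T) x = size mu.
  by rewrite -[RHS](mkseq_nth 0); apply: eq_mkseq.
apply/eqP; rewrite eqn_leq; apply/andP; split.
  apply/bigmax_leqP_seq => -[|x] //= xT _; rewrite ltnNge; apply/negP => le.
  by move: xT; rewrite -has_pred1 has_count H nth_default.
by case E: (size mu) => [//|m]; apply: leq_bigmax_seq => //; exact: lastmu.
Qed.

Lemma row_wordE T N : size T <= N -> row_word T = flatten (rev (mkseq (nth [::] T) N)).
Proof.
move=> /subnKC <-; elim: (N - size T) => [|d IH]; first by rewrite addn0 mkseq_nth.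
by rewrite addnS mkseqS rev_rcons /= -IH nth_default // leq_addr.
Qed.

Definition ssyts (la mu : seq nat) : seq (seq (seq nat)) :=
  [seq val T | T <- enum {: ssyt la mu}].

Lemma mem_ssyts la mu T : (T \in ssyts la mu) =
  [&& semistandard T, shape T == la & content T == mu].
Proof.
apply/mapP/idP => [[x _ ->]|H]; first exact: (valP x).
by exists (Ssyt H); rewrite ?mem_enum.
Qed.

Lemma ssyts_uniq la mu : uniq (ssyts la mu).
Proof. by rewrite map_inj_uniq ?enum_uniq //; apply: val_inj. Qed.

Lemma big_ssyts (V : nmodType) la mu (F : seq (seq nat) -> V) :
  (\sum_(T <- ssyts la mu) F T = \sum_(T : ssyt la mu) F T)%R.
Proof. by rewrite big_map big_enum. Qed.

Lemma sorted_split m r : sorted leq r -> all (fun x => x <= m.+1) r ->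
  r = [seq x <- r | x <= m] ++ nseq (count_mem m.+1 r) m.+1.
Proof.
elim: r => //= x r IH xr /andP[xm rm].
have {}IH := IH (path_sorted xr) rm.
have [xle|mx] := leqP x m; first by rewrite ltn_eqF ?ltnS //= {1}IH.
have xE : x = m.+1 by apply/eqP; rewrite eqn_leq xm.
have F : [seq x <- r | x <= m] = [::].
  apply/eqP; rewrite -(negbK (_ == _)) -has_filter; apply/hasPn => y yr.
  by have /allP/(_ y yr) := order_path_min leq_trans xr; rewrite xE ltnNge.
by rewrite F xE eqxx /= -[in RHS](cat0s (nseq _ _)) -F -IH.
Qed.

Lemma sorted_cat_nseq m r k : sorted leq r -> all (fun x => x <= m) r ->
  sorted leq (r ++ nseq k m.+1).
Proof.
rewrite !(sorted_pairwise leq_trans) pairwise_cat => -> /allP rm /=.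
rewrite -(sorted_pairwise leq_trans); apply/andP; split.
  by apply/allrelP => x y /rm xm; rewrite mem_nseq => /andP[_ /eqP ->]; apply: leqW.
by elim: k => //= -[|k] //= ->; rewrite leqnn.
Qed.

Lemma filter_cat_nseq m r k : all (fun x => x <= m) r ->
  [seq x <- r ++ nseq k m.+1 | x <= m] = r.
Proof.
move=> rm; rewrite filter_cat (all_filterP rm).
by rewrite (_ : filter _ (nseq k _) = [::]) ?cats0 //; elim: k => //= k ->; rewrite ltnn.
Qed.

(** * Removing and adding the largest letter *)

Section Restrict.
Variables (m : nat) (T : seq (seq nat)).
Hypothesis sT : semistandard T.
Hypothesis Tm : forall i, all (fun x => x <= m.+1) (nth [::] T i).
Local Notation R := (nth [::] T).

Definition restrict_rows (i : nat) := [seq x <- nth [::] T i | x <= m].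
Definition restrict := mkrows restrict_rows (size T).
Local Notation Q := restrict_rows.

Lemma row_split i : R i = Q i ++ nseq (size (R i) - size (Q i)) m.+1.
Proof.
have [_ [s1 _ _ _]] := semistandardP _ sT.
have E := sorted_split (s1 i) (Tm i).
by rewrite {1}E {3}E size_cat size_nseq addKn.
Qed.

(** By column strictness a box below a letter m+1 would hold a larger letter, so the letters m+1
    occupy a horizontal strip. *)
Lemma restrict_strip i : size (R i.+1) <= size (Q i) <= size (R i).
Proof.
have [_ [_ _ s3 s4]] := semistandardP _ sT.
rewrite {2}size_filter count_size andbT leqNgt; apply/negP => lt.
(* In column [size (Q i)] the letters up to [m] of row [i] are exhausted, so the entry there is
   m+1. *)
have := s4 i _ lt; rewrite {1}row_split nth_cat ltnn subnn nth_nseq.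
rewrite subn_gt0 (leq_trans lt (s3 i)) ltnNge.
by have /allP -> := Tm i.+1; rewrite ?mem_nth.
Qed.

Lemma restrict_ss_rows : ss_rows Q.
Proof.
have [_ [s1 s2 s3 s4]] := semistandardP _ sT.
split=> [i|i|i|i j jlt].
- by apply: sorted_filter (s1 i); exact: leq_trans.
- by rewrite mem_filter negb_and (s2 i) orbT.
- have := restrict_strip i; have := restrict_strip i.+1; lia.
have lt1 : j < size (R i.+1) by have := restrict_strip i.+1; lia.
have lt0 : j < size (Q i) by have := restrict_strip i; lia.
have := s4 i j lt1; rewrite {1}(row_split i) {1}(row_split i.+1).
by rewrite !nth_cat jlt lt0.
Qed.

Lemma nth_restrict i : nth [::] restrict i = Q i.
Proof.
have [_ _ s3 _] := restrict_ss_rows.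
by rewrite nth_mkrows // /Q nth_default.
Qed.

Lemma restrict_semistandard : semistandard restrict.
Proof.
by apply: mkrows_semistandard; [exact: restrict_ss_rows|rewrite /Q nth_default].
Qed.

Lemma size_restrict : size restrict <= size T.
Proof.
rewrite leqNgt; apply/negP => lt.
have /semistandardP[sh0 _] := restrict_semistandard.
move/negP: sh0; apply; apply/(nthP 0); exists (size T); rewrite ?size_map //.
by rewrite nth_shape nth_restrict /Q nth_default.
Qed.

Lemma count_restrict x : count_mem x.+1 (flatten restrict) =
  if x < m then count_mem x.+1 (flatten T) else 0.
Proof.
rewrite !(@count_flatten_nth _ _ (size T)) ?size_restrict //.
case: ifP => xm.
  apply: eq_bigr => i _; rewrite nth_restrict count_filter; apply: eq_count => y /=.
  by case: eqP => // ->; rewrite xm.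
rewrite big1 // => i _; rewrite nth_restrict; apply/count_memPn.
by rewrite mem_filter xm.
Qed.

Lemma sumn_shape_restrict :
  sumn (shape T) = sumn (shape restrict) + count_mem m.+1 (flatten T).
Proof.
rewrite (@sumn_nth _ (size T)) ?size_map // (@sumn_nth (shape restrict) (size T)).
  rewrite (@count_flatten_nth _ _ (size T)) // -big_split.
  apply: eq_bigr => i _; rewrite !nth_shape nth_restrict /= {1}row_split size_cat.
  congr (_ + _); rewrite {2}row_split count_cat count_nseq /= eqxx mul1n size_nseq.
  by rewrite (count_memPn _) // mem_filter ltnn.
by rewrite size_map size_restrict.
Qed.

Lemma tab_sign_restrict :
  tab_sign T = (sgn (strip_inv (shape restrict) (shape T)) * tab_sign restrict)%R.
Proof.
rewrite /tab_sign !inversionsE (@row_wordE T (size T)) //.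
rewrite (@row_wordE restrict (size T)) ?size_restrict //.
have -> : mkseq R (size T) =
    mkseq (fun i => Q i ++ nseq (size (R i) - size (Q i)) m.+1) (size T).
  by apply: eq_map => i; apply: row_split.
rewrite inv_word_extend => [|i]; last exact: filter_all.
rewrite exprD mulrC (eq_mkseq nth_restrict); congr (_ * _)%R; congr (_ ^+ _)%R.
rewrite /strip_inv size_map; apply: eq_bigr => i _; rewrite !nth_shape nth_restrict.
by congr (_ * _); apply: eq_bigr => q _; rewrite nth_shape nth_restrict.
Qed.

End Restrict.

Section Extend.
Variables (m : nat) (la : seq nat) (T : seq (seq nat)).
Hypothesis sT : semistandard T.
Hypothesis pl : is_part la.
Hypothesis Tm : forall i, all (fun x => x <= m) (nth [::] T i).
Hypothesis Tla : strip (shape T) la.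
Local Notation R := (nth [::] T).

Definition extend_rows (i : nat) :=
  nth [::] T i ++ nseq (nth 0 la i - size (nth [::] T i)) m.+1.
Definition extend := mkrows extend_rows (size la).
Local Notation Q := extend_rows.

Let szR i : nth 0 la i.+1 <= size (R i) <= nth 0 la i.
Proof. by rewrite -nth_shape; apply: (stripP _ _ Tla). Qed.

Lemma size_extend_rows i : size (Q i) = nth 0 la i.
Proof. by rewrite size_cat size_nseq; have := szR i; lia. Qed.

Lemma extend_ss_rows : ss_rows Q.
Proof.
have [_ [s1 s2 s3 s4]] := semistandardP _ sT.
split=> [i|i|i|i j].
- exact: sorted_cat_nseq.
- by rewrite mem_cat (negPf (s2 i)) mem_nseq andbF.
- by rewrite !size_extend_rows is_part_nthS.
rewrite size_extend_rows => jla; rewrite !nth_cat.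
have ji : j < size (R i) by have := szR i; lia.
rewrite ji; case: ifP => [|jj]; first exact: s4.
rewrite nth_nseq ifT; first by rewrite ltnS (allP (Tm i)) // mem_nth.
by lia.
Qed.

Let Qla : Q (size la) = [::].
Proof. by apply/nilP; rewrite /nilp size_extend_rows nth_default. Qed.

Lemma nth_extend i : nth [::] extend i = Q i.
Proof. by have [_ _ s3 _] := extend_ss_rows; rewrite nth_mkrows. Qed.

Lemma extend_semistandard : semistandard extend.
Proof. exact: mkrows_semistandard extend_ss_rows Qla. Qed.

Lemma shape_extend : shape extend = la.
Proof.
apply: is_part_inj => // [|i].
  by case/and4P: extend_semistandard.
by rewrite nth_shape nth_extend size_extend_rows.
Qed.

Lemma extend_le i : all (fun x => x <= m.+1) (nth [::] extend i).
Proof.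
rewrite nth_extend all_cat all_nseq leqnn orbT andbT.
by apply: sub_all (Tm i) => x; apply: leqW.
Qed.

Lemma extendK : restrict m extend = T.
Proof.
have /semistandardP[sh0 _] := sT.
apply: rows_inj => // [|i]; first exact: mkrows_nonempty.
rewrite nth_restrict; [|exact: extend_semistandard|exact: extend_le].
by rewrite /restrict_rows nth_extend filter_cat_nseq.
Qed.
End Extend.

Lemma restrictK m T : semistandard T ->
  (forall i, all (fun x => x <= m.+1) (nth [::] T i)) ->
  extend m (shape T) (restrict m T) = T.
Proof.
move=> sT Tm; have /semistandardP[sh0 _] := sT.
have pT : is_part (shape T) by case/and4P: sT.
have S : strip (shape (restrict m T)) (shape T).
  by apply/stripP => i; rewrite !nth_shape nth_restrict // restrict_strip.
apply: rows_inj => // [|i]; first exact: mkrows_nonempty.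
rewrite nth_extend ?restrict_semistandard // => [|j]; last first.
  by rewrite nth_restrict // filter_all.
by rewrite /extend_rows nth_restrict // nth_shape -row_split.
Qed.

(** * Signed tableau sums as iterated strip sums *)

Lemma content_row_le la mu T i : 0 \notin mu -> T \in ssyts la mu ->
  all (fun x => x <= size mu) (nth [::] T i).
Proof.
move=> mu0; rewrite mem_ssyts => /and3P[sT _ cT].
have [lt|le] := ltnP i (size T); last by rewrite nth_default.
apply/allP => x xT; rewrite -(eqP cT); apply: leq_max_content.
by apply/flattenP; exists (nth [::] T i) => //; rewrite mem_nth.
Qed.

(** Groups the tableaux by the shape [r] left after deleting the largest letter. For each [r],
    [restrict] and [extend] are inverse bijections, and [tab_sign_restrict] supplies the sign. *)
Lemma sum_ssyts_rcons la mu b : is_part la -> 0 \notin rcons mu b ->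
  (\sum_(T <- ssyts la (rcons mu b)) tab_sign T =
   \sum_(r <- parts (sumn la - b) | (b <= sumn la)%N && strip r la)
      sgn (strip_inv r la) * \sum_(T <- ssyts r mu) tab_sign T)%R.
Proof.
move=> pla mub0; set m := size mu.
have mu0 : 0 \notin mu by move: mub0; rewrite mem_rcons inE negb_or => /andP[].
have rP T : T \in ssyts la (rcons mu b) ->
    [/\ restrict m T \in ssyts (shape (restrict m T)) mu,
        shape (restrict m T) \in parts (sumn la - b), b <= sumn la
      & strip (shape (restrict m T)) la].
  move=> Tin; have := Tin; rewrite mem_ssyts => /and3P[sT /eqP shT /(contentP _ mub0) cT].
  have Tm i : all (fun x => x <= m.+1) (nth [::] T i).
    by have := content_row_le i mub0 Tin; rewrite size_rcons.
  have sR := restrict_semistandard sT Tm.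
  have := sumn_shape_restrict sT Tm; rewrite cT shT nth_rcons ltnn eqxx => E.
  split.
  - rewrite mem_ssyts sR eqxx /=; apply/contentP => // x.
    rewrite count_restrict // cT nth_rcons -/m.
    by case: ltnP => // le; rewrite nth_default.
  - rewrite mem_parts; have [-> _ _ _] := and4P sR.
    by rewrite E addnK eqxx.
  - by rewrite E leq_addl.
  by apply/stripP => i; rewrite -shT !nth_shape nth_restrict // restrict_strip.
(* Each tableau is listed under its single value of [r], so that the two sums can be exchanged. *)
transitivity (\sum_(T <- ssyts la (rcons mu b))
   \sum_(r <- parts (sumn la - b) | [&& (b <= sumn la)%N, strip r la
      & r == shape (restrict m T)]) tab_sign T)%R.
  rewrite big_seq [RHS]big_seq; apply: eq_bigr => T /rP[_ pin bla st].
  rewrite (@big_rem _ _ _ _ _ (shape (restrict m T))) // bla st eqxx /=.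
  rewrite big1_seq ?addr0 // => r /andP[/andP[_ /eqP ->]].
  by rewrite mem_rem_uniq ?parts_uniq // !inE eqxx.
rewrite (exchange_big_dep (fun r => (b <= sumn la) && strip r la)) /=; last first.
  by move=> T r _ /and3P[-> ->].
rewrite big_seq_cond [RHS]big_seq_cond; apply: eq_bigr => r.
rewrite mem_parts => /andP[/andP[pr /eqP rE] /andP[bla st]].
rewrite mulr_sumr.
apply: (@big_seq_bij _ _ _ _ _ _ _ (restrict m) (extend m la)); rewrite ?ssyts_uniq //.
- move=> T Tin /and3P[_ _ /eqP E]; have [tin _ _ _] := rP T Tin; rewrite -E in tin.
  have := Tin; rewrite mem_ssyts => /and3P[sT /eqP shT cT].
  have Tm i : all (fun x => x <= m.+1) (nth [::] T i).
    by have := content_row_le i mub0 Tin; rewrite size_rcons.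
  split=> //; first by rewrite -shT restrictK.
  by rewrite (tab_sign_restrict sT Tm) -E shT.
move=> T Tin _; have := Tin; rewrite mem_ssyts => /and3P[sT /eqP shT /(contentP _ mu0) cT].
have Tm i := content_row_le i mu0 Tin; rewrite -/m in Tm.
have stT : strip (shape T) la by rewrite shT.
have sE := extend_semistandard sT pla Tm stT.
have Em := extend_le sT pla Tm stT.
have EK := extendK sT pla Tm stT.
have shE := shape_extend sT pla Tm stT.
split=> //; last by rewrite bla st EK shT eqxx.
rewrite mem_ssyts sE shE eqxx /=; apply/contentP => // x.
have := count_restrict sE Em x; rewrite EK cT nth_rcons -/m.
case: ltnP => [_ ->//|mx _].
(* The multiplicity of m+1 follows from the sizes of the two shapes; larger letters do not occur. *)
have [->|xm] := eqVneq x m.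
  have := sumn_shape_restrict sE Em; rewrite EK shE shT rE; move: bla; clear; lia.
apply/count_memPn/negP => /flattenP[row /(nthP [::])[i _ <-]] xin.
by have /allP/(_ _ xin) := Em i; move/eqP: xm mx; clear; lia.
Qed.

(** The list is reversed because [strip_sum] peels off the largest letter first. *)
Lemma sum_tab_sign la mu : is_part la -> 0 \notin mu ->
  (\sum_(T : ssyt la mu) tab_sign T = strip_sum (rev mu) la)%R.
Proof.
rewrite -big_ssyts; elim/last_ind: mu la => [|mu b IH] la pla mu0.
  rewrite /=; case: eqP => [->|la0].
    rewrite (@big_rem _ _ _ _ _ [::]); last by rewrite mem_ssyts /content /= big_nil.
    rewrite /= big1_seq ?addr0 => [|T /andP[_]]; first by rewrite /tab_sign inversionsE.
    rewrite mem_rem_uniq ?ssyts_uniq // !inE mem_ssyts => /and3P[T0 _ /andP[/eqP shT _]].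
    by case: (T) T0 shT.
  rewrite big1_seq // => T /andP[_].
  rewrite mem_ssyts => /and3P[sT /eqP shT /(contentP _ mu0) cT].
  have /semistandardP[_ [_ s2 _ _]] := sT; case: T sT shT cT s2 => [_ shT|row T sT shT cT s2].
    by rewrite -shT in la0.
  have : 0 < size row by have := @part_nth_gt0 la 0 pla; rewrite -shT; apply.
  case: row {sT shT} cT s2 => // -[|x] row cT s2 _; first by have := s2 0; rewrite inE.
  by have := cT x; rewrite /= eqxx nth_nil.
rewrite sum_ssyts_rcons // rev_rcons /=.
rewrite big_seq_cond [RHS]big_seq_cond; apply: eq_bigr => r.
rewrite mem_parts => /andP[/andP[pr _] _]; rewrite IH //.
by move: mu0; rewrite mem_rcons inE negb_or => /andP[].
Qed.

(** * Double cosets of Young subgroups *)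

Section CoxeterLength.
Variable n : nat.
Implicit Types (i j : 'I_n) (s : 'S_n).
Local Open Scope group_scope.

Definition inv_set s : {set 'I_n * 'I_n} :=
  [set p : 'I_n * 'I_n | (p.1 < p.2)%N && (s p.2 < s p.1)%N].

Lemma tperm_adj_lt i j (x y : 'I_n) : j = i.+1 :> nat -> (x < y)%N -> (x, y) != (i, j) ->
  (tperm i j x < tperm i j y)%N.
Proof.
move=> ij xy; rewrite xpair_eqE negb_and !permE /= -!val_eqE /=.
by repeat case: ifP => ?; lia.
Qed.

(** An adjacent transposition preserves the order of every pair except (i, j), so it carries the
    remaining inversions of one permutation to those of the other. *)
Lemma card_inv_tperm i j s : j = i.+1 :> nat ->
  (#|inv_set (tperm i j * s)| + (s j < s i)%N = #|inv_set s| + (s i < s j)%N)%N.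
Proof.
move=> ij; rewrite (cardsD1 (i, j)) (cardsD1 (i, j) (inv_set s)).
have lt_ij : (i < j)%N by rewrite ij.
rewrite !inE /= !permM tpermL tpermR lt_ij /=.
set A := _ :\ _; set B := _ :\ _; suff -> : #|A| = #|B| by rewrite addnC addnCA addnC.
pose f (p : 'I_n * 'I_n) := (tperm i j p.1, tperm i j p.2).
have fK : involutive f by case=> x y; rewrite /f /= !tpermK.
have -> : A = f @^-1: B.
  apply/setP => -[x y]; rewrite !inE /f /= !permM.
  have [|_] /= := boolP (s (tperm i j y) < s (tperm i j x))%N; rewrite ?andbF // !andbT => _.
  apply/andP/andP => -[ne lt].
    split; last exact: tperm_adj_lt.
    apply/eqP => -[xE yE]; move: lt.
    by rewrite -(tpermK i j x) -(tpermK i j y) xE yE tpermL tpermR ltnNge ltnW.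
  have lt' := tperm_adj_lt ij lt ne; rewrite !tpermK in lt'; split=> //.
  by apply/eqP => -[xE yE]; move: lt; rewrite xE yE tpermL tpermR ltnNge ltnW.
by rewrite on_card_preimset //; exists f => x _; apply: fK.
Qed.

(** The classes of [b] are intervals, so the neighbours leading from i to j stay in the class.
    Applied with [b] constant and with [b] the block labels. *)
Lemma ltn_convex_class (f b : 'I_n -> nat) :
    (forall i (l : 'I_n) j, i <= l <= j -> b i = b j -> b l = b i)%N ->
    (forall i j, j = i.+1 :> nat -> b i = b j -> f i < f j)%N ->
  forall i j, (i < j)%N -> b i = b j -> (f i < f j)%N.
Proof.
move=> cvx adj i j /subnKC; move: (j - i.+1)%N => d; elim: d j => [|d IH] j.
  by rewrite addn0 => /esym; apply: adj.
move=> dj bij; have lt : (i.+1 + d < n)%N by rewrite (leq_trans _ (ltn_ord j)) // -dj addnS.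
pose l := Ordinal lt.
have bl : b l = b i by apply: (cvx _ _ j) => //=; lia.
apply: ltn_trans (IH l _ _) (adj l j _ _) => //=; rewrite ?bl //; lia.
Qed.

Lemma increasing_perm_ge s : (forall i j, i < j -> s i < s j)%N -> forall i, (i <= s i)%N.
Proof.
move=> ms [i lti] /=; elim: i lti => // i IH lti.
by apply: leq_ltn_trans (IH (ltnW lti)) _; apply: ms.
Qed.

(** The inverse is increasing too, and i <= s i holds for both. *)
Lemma increasing_perm1 s : (forall i j, i < j -> s i < s j)%N -> s = 1.
Proof.
move=> ms; have mV i j : (i < j)%N -> (s^-1 i < s^-1 j)%N.
  rewrite ltnNge [in X in _ -> X]ltnNge; apply: contraNN; rewrite leq_eqVlt.
  case/predU1P => [/val_inj/perm_inj ->//|/ms]; rewrite !permKV; exact: ltnW.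
apply/permP => i; rewrite perm1; apply/val_inj/eqP.
rewrite eqn_leq (increasing_perm_ge ms) andbT.
by have := increasing_perm_ge mV (s i); rewrite permK.
Qed.

(** Each simple factor adds at most one inversion. *)
Lemma inv_set_le s k : s \in simple_refls n ^+ k -> (#|inv_set s| <= k)%N.
Proof.
elim: k s => [|k IH] s.
  rewrite expg0 inE => /eqP ->; rewrite leqn0 cards_eq0; apply/eqP/setP => p.
  by rewrite !inE !perm1; case: ltngtP.
rewrite expgS => /mulsgP[t u /imsetP[[i j]]]; rewrite inE /= => /eqP ij -> uk ->.
apply: leq_trans (leq_addr (u j < u i)%N _) _; rewrite card_inv_tperm //.
by rewrite -[k.+1]addn1 leq_add ?IH //; case: (_ < _)%N.
Qed.

Lemma no_descent_perm1 s :
  (forall i j, j = i.+1 :> nat -> (s i < s j)%N) -> s = 1.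
Proof.
move=> adj; apply: increasing_perm1 => i j ij.
by apply: (ltn_convex_class (f := fun i => s i) (b := fun=> 0%N)) => // i' j' /adj.
Qed.

(** A permutation other than 1 has a descent between neighbours; undoing it removes exactly one
    inversion. *)
Lemma simple_word_inv s : s \in simple_refls n ^+ #|inv_set s|.
Proof.
move: {2}(#|inv_set s|.+1) (ltnSn #|inv_set s|) => k; elim: k s => // k IH s sk.
case: (boolP [exists p : 'I_n * 'I_n, (p.2 == p.1.+1 :> nat) && (s p.2 < s p.1)%N]).
  case/existsP => -[i j] /= /andP[/eqP ij ji].
  have := card_inv_tperm s ij; rewrite ji [(s i < s j)%N]ltnNge ltnW //= addn1 addn0 => E.
  rewrite -E expgS -[X in X \in _](mulKg (tperm i j)) tpermV mem_mulg //.
    by apply/imsetP; exists (i, j) => //; rewrite inE /= ij.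
  by apply: IH; rewrite -ltnS E.
move/existsPn => adj; rewrite (@no_descent_perm1 s) => [|i j ij].
  have : 1 \in simple_refls n ^+ 0 by rewrite expg0 inE.
  by move/inv_set_le; rewrite leqn0 => /eqP ->; rewrite expg0 inE.
have := adj (i, j); rewrite /= ij eqxx /= -leqNgt leq_eqVlt => /predU1P[/val_inj/perm_inj E|//].
by move: ij; rewrite E => /n_Sn.
Qed.

Lemma coxeter_lengthE s : coxeter_length s = #|inv_set s|.
Proof.
rewrite /coxeter_length; case: ex_minnP => k sk mink.
by apply/eqP; rewrite eqn_leq mink ?simple_word_inv //= inv_set_le.
Qed.
End CoxeterLength.

(** * Matrices with prescribed margins *)

Fixpoint margin_mats (mu nu : seq nat) : seq (seq (seq nat)) :=
  if mu is a :: mu' then [seq c :: M | c <- bounded_rows a nu, M <- margin_mats mu' (row_sub nu c)]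
  else if sumn nu == 0 then [:: [::]] else [::].

(** The sum of M_pq M_p'q' over p < p' and q' < q, see [mat_invE]. *)
Fixpoint mat_inv (M : seq (seq nat)) : nat :=
  if M is c :: M' then \sum_(d <- M') row_inv c d + mat_inv M' else 0.

Lemma row_inv_sub c d nu : all2 leq d nu ->
  row_inv c d + row_inv c (row_sub nu d) = row_inv c nu.
Proof.
elim: c d nu => [|x c IH] [|y d] [|z nu] //= /andP[yz /IH <-].
by rewrite addnACA -mulnDr subnKC.
Qed.

Lemma row_inv0 c nu : sumn nu = 0 -> row_inv c nu = 0.
Proof.
elim: c nu => [|x c IH] [|z nu] //= /eqP; rewrite addn_eq0 => /andP[/eqP -> /eqP n0].
by rewrite muln0 IH.
Qed.

(** [row_inv] is additive in its second argument, so a row interacts with the rows below only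
    through their column sums. This justifies the sign in [signed_mats]. *)
Lemma sum_row_inv_mats c mu nu M : M \in margin_mats mu nu ->
  \sum_(d <- M) row_inv c d = row_inv c nu.
Proof.
elim: mu nu M => [|a mu IH] nu M /=.
  case: eqP => // n0; rewrite inE => /eqP ->; by rewrite big_nil row_inv0.
case/allpairsPdep => d [N [din Nin ->]]; rewrite big_cons (IH _ _ Nin) row_inv_sub //.
by move: din; rewrite mem_bounded_rows => /andP[].
Qed.

Lemma signed_matsE mu nu :
  (signed_mats mu nu = \sum_(M <- margin_mats mu nu) sgn (mat_inv M))%R.
Proof.
elim: mu nu => [|a mu IH] nu /=.
  by case: eqP => _; rewrite ?big_seq1 ?big_nil.
rewrite big_allpairs_dep; apply: eq_bigr => c _; rewrite IH mulr_sumr.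
rewrite big_seq [RHS]big_seq; apply: eq_bigr => M Min.
by rewrite /= exprD (sum_row_inv_mats c Min).
Qed.

Lemma bounded_rows_uniq a nu : uniq (bounded_rows a nu).
Proof.
elim: nu a => [|b nu IH] a; first by rewrite /=; case: ifP.
rewrite bounded_rows_cons; apply: allpairs_uniq_dep => //; first exact: iota_uniq.
by move=> [x c] [y d] _ _ /= [-> ->].
Qed.

Lemma margin_mats_uniq mu nu : uniq (margin_mats mu nu).
Proof.
elim: mu nu => [|a mu IH] nu /=; first by case: ifP.
apply: allpairs_uniq_dep => //; first exact: bounded_rows_uniq.
by move=> [x c] [y d] _ _ /= [-> ->].
Qed.

Lemma all2_leqP c nu : size c = size nu ->
  reflect (forall q, nth 0 c q <= nth 0 nu q) (all2 leq c nu).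
Proof.
elim: c nu => [|x c IH] [|y nu] //=; first by constructor=> q; rewrite nth_nil.
move=> /succn_inj /IH {}IH; apply: (iffP andP) => [[xy /IH H] [|q] //|H].
  exact: H.
by split; [exact: (H 0)|apply/IH => q; exact: (H q.+1)].
Qed.

Lemma all2_leq_size c nu : all2 leq c nu -> size c = size nu.
Proof. by rewrite all2E => /andP[/eqP]. Qed.

Lemma size_row_sub c nu : size c = size nu -> size (row_sub nu c) = size nu.
Proof. by move=> E; rewrite size_map size_zip E minnn. Qed.

Lemma nth_row_sub c nu q : size c = size nu ->
  nth 0 (row_sub nu c) q = nth 0 nu q - nth 0 c q.
Proof.
elim: c nu q => [|x c IH] [|y nu] // q; first by rewrite !nth_nil.
by case=> sz; case: q => //= q; apply: IH.
Qed.

Lemma mem_margin_mats mu nu M :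
  (M \in margin_mats mu nu) <->
  [/\ [seq sumn c | c <- M] = mu, forall c, c \in M -> size c = size nu
    & forall q, \sum_(c <- M) nth 0 c q = nth 0 nu q].
Proof.
elim: mu nu M => [|a mu IH] nu M /=.
  have n0P : reflect (forall q, 0 = nth 0 nu q) (sumn nu == 0).
    elim: (nu) => [|x s IHs]; first by constructor=> q; rewrite nth_nil.
    rewrite /= addn_eq0; apply: (iffP andP) => [[/eqP -> /IHs H] [|q] //|H].
      exact: H.
    by split; [apply/eqP/esym/(H 0)|apply/IHs => q; exact: (H q.+1)].
  split=> [|[M0 _ Mq]].
    case: n0P => // n0; rewrite inE => /eqP ->; split=> // q.
    by rewrite big_nil.
  by case: M M0 Mq => // _ Mq; rewrite ifT ?inE //; apply/n0P => q; rewrite -Mq big_nil.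
split.
  case/allpairsPdep => c [N [cin /IH[<- Nsz Nq] ->]].
  move: cin; rewrite mem_bounded_rows => /andP[/eqP <- cn].
  have szc := all2_leq_size cn; have /(all2_leqP szc) cle := cn.
  split=> //= [d|q].
    by rewrite inE => /predU1P[->//|/Nsz ->]; rewrite size_row_sub.
  by rewrite big_cons Nq nth_row_sub // subnKC.
case: M => [|c M] [] //= [ca Mmu] Msz Mq.
have szc : size c = size nu by apply: Msz; rewrite inE eqxx.
have cle q : nth 0 c q <= nth 0 nu q by rewrite -Mq big_cons leq_addr.
apply/allpairsPdep; exists c, M; split=> //.
  by rewrite mem_bounded_rows ca eqxx; apply/all2_leqP.
apply/IH; split=> // [d dM|q].
  by rewrite size_row_sub // Msz // inE dM orbT.
by rewrite nth_row_sub // -Mq big_cons addKn.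
Qed.

Lemma row_invE c d l : size c = l -> size d = l ->
  row_inv c d = \sum_(q < l) \sum_(q' < l | q' < q) nth 0 c q * nth 0 d q'.
Proof.
elim: l c d => [|l IH] [|x c] [|y d] //= => [_ _|[szc] [szd]].
  by rewrite big_ord0.
rewrite big_ord_recl /= big_pred0 // add0n (sumn_nth (s := c) (N := l)) ?szc //.
rewrite (IH _ _ szc szd) big_distrl -big_split /=; apply: eq_bigr => i _.
by rewrite [in RHS]big_mkcond big_ord_recl /= -big_mkcond.
Qed.

Lemma mat_invE M l : (forall c, c \in M -> size c = l) ->
  mat_inv M = \sum_(p < size M) \sum_(p' < size M | p < p') \sum_(q < l)
    \sum_(q' < l | q' < q) nth 0 (nth [::] M p) q * nth 0 (nth [::] M p') q'.
Proof.
elim: M => [|c M IH] Msz /=; first by rewrite big_ord0.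
rewrite big_ord_recl; congr (_ + _).
  rewrite [RHS]big_mkcond big_ord_recl /= add0n (big_nth [::]) big_mkord.
  apply: eq_bigr => i _; rewrite (@row_invE _ _ l) //; first by apply: Msz; rewrite inE eqxx.
  by apply: Msz; rewrite inE mem_nth ?orbT.
rewrite IH => [|d dM]; last by apply: Msz; rewrite inE dM orbT.
by apply: eq_bigr => i _; rewrite [in RHS]big_mkcond big_ord_recl /= -big_mkcond.
Qed.

(** * Blocks of a composition and fibres of labellings *)

Lemma reshape_index_cons x s i :
  reshape_index (x :: s) i = if i < x then 0 else (reshape_index s (i - x)).+1.
Proof.
rewrite /reshape_index /= subn_eq0; case: ltnP => // le.
by rewrite subSn.
Qed.

Lemma reshape_index_le s i j : i <= j -> reshape_index s i <= reshape_index s j.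
Proof.
elim: s i j => [|x s IH] i j ij //; rewrite !reshape_index_cons.
case: (ltnP i x) => // xi; rewrite [j < x]ltnNge (leq_trans xi ij) /= ltnS.
exact/IH/leq_sub2r.
Qed.

Lemma count_reshape_index s q :
  count (fun i => reshape_index s i == q) (iota 0 (sumn s)) = nth 0 s q.
Proof.
elim: s q => [|x s IH] q /=; first by rewrite nth_nil.
rewrite iotaD count_cat.
have -> : count (fun i => reshape_index (x :: s) i == q) (iota 0 x) = x * (q == 0).
  rewrite (eq_in_count (a2 := fun=> q == 0)) => [|i].
    case: eqP => _; last by rewrite muln0; exact: count_pred0.
    by rewrite muln1 -[RHS](size_iota 0); exact: count_predT.
  by rewrite [q == 0]eq_sym mem_iota => /= ix; rewrite reshape_index_cons ix.
have -> : count (fun i => reshape_index (x :: s) i == q) (iota (0 + x) (sumn s)) =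
    count (fun i => (reshape_index s i).+1 == q) (iota 0 (sumn s)).
  rewrite add0n -[in iota x _](addn0 x) iotaDl count_map; apply: eq_count => i /=.
  by rewrite reshape_index_cons ltnNge leq_addr /= addKn.
case: q => [|q] /=; first by rewrite muln1 (eq_count (a2 := pred0)) ?count_pred0 ?addn0.
by rewrite muln0 -IH.
Qed.

Lemma card_ord_count n (P : pred nat) : #|[set i : 'I_n | P i]| = count P (iota 0 n).
Proof.
rewrite cardsE -sum1_card -(big_mkord P (fun=> 1)) sum1_count.
by rewrite /index_iota subn0.
Qed.

Lemma sum_card_fiber (T : finType) (P : pred T) (f : T -> nat) (Q : pred nat) l :
    (forall x, P x -> (f x < l) && Q (f x)) ->
  \sum_(q < l | Q q) #|[set x | P x && (f x == q)]| = #|[set x | P x]|.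
Proof.
move=> H; under eq_bigr do rewrite cardsE -sum1_card.
rewrite (exchange_big_dep P) /=; last by move=> q x _ /andP[].
rewrite cardsE -sum1_card; apply: eq_bigr => x Px.
have /andP[lt Qx] := H x Px; rewrite (big_pred1 (Ordinal lt)) // => q.
rewrite unfold_in Px /= -val_eqE /= eq_sym; case: eqP => [->|]; rewrite ?Qx ?andbF //.
Qed.

(** Equal fibre sizes mean that the two lists of values are rearrangements of each other. *)
Lemma eq_fibers_perm n (T : eqType) (f g : 'I_n -> T) :
    (forall t, #|[set i | f i == t]| = #|[set i | g i == t]|) ->
  exists s : 'S_n, forall i, g i = f (s i).
Proof.
move=> fg; have cE (h : 'I_n -> T) t : count_mem t [tuple h i | i < n] = #|[set i | h i == t]|.
  by rewrite /= count_map cardsE cardE -size_filter enumT.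
have /tuple_permP[s sE] : perm_eq [tuple g i | i < n] [tuple f i | i < n].
  by apply/allP => t _ /=; rewrite !cE fg.
exists s => i; have := congr1 (nth (g i) ^~ i) sE.
by rewrite -!tnth_nth !tnth_mktuple.
Qed.

Lemma big_iota_ord m (F : nat -> nat) : \sum_(p <- iota 0 m) F p = \sum_(p < m) F p.
Proof. by rewrite -(big_mkord xpredT F) /index_iota subn0. Qed.

Lemma card_perm_set n (w : 'S_n) (P : pred 'I_n) : #|[set i | P (w i)]| = #|[set i | P i]|.
Proof.
rewrite -(card_preimset [set i | P i] (@perm_inj _ w)); apply: eq_card => i.
by rewrite !inE.
Qed.

(* Blocks are numbered from the last one, to match the convention of [strip_sum]. *)
Definition block_label (s : seq nat) (i : nat) : nat := (size s).-1 - reshape_index s i.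

Lemma block_label_lt s i : i < sumn s -> block_label s i < size s.
Proof. by move/reshape_indexP; rewrite /block_label; lia. Qed.

Lemma block_label_ge s i j : i <= j -> block_label s j <= block_label s i.
Proof. by move=> ij; apply: leq_sub2l; apply: reshape_index_le. Qed.

Lemma block_label_eq s i j : i < sumn s -> j < sumn s ->
  (block_label s i == block_label s j) = (reshape_index s i == reshape_index s j).
Proof.
move=> /reshape_indexP si /reshape_indexP sj; rewrite /block_label.
by apply/eqP/eqP; lia.
Qed.

Lemma card_block_label s p : #|[set i : 'I_(sumn s) | block_label s i == p]| = nth 0 (rev s) p.
Proof.
have [pl|pl] := ltnP p (size s); last first.
  rewrite nth_default ?size_rev //; apply: eq_card0 => i; rewrite !inE.
  by apply/negbTE; rewrite neq_ltn (leq_trans (block_label_lt _)).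
rewrite nth_rev // -count_reshape_index -card_ord_count; apply: eq_card => i.
rewrite !inE /block_label; have := reshape_indexP (ltn_ord i).
by move: pl; clear; move: (reshape_index _ _) => r *; apply/eqP/eqP; lia.
Qed.

(** * The matrix of a double coset *)

Section Cosets.
Variables (n : nat) (b a : seq nat).
Hypotheses (bn : sumn b = n) (an : sumn a = n).
Implicit Types w : 'S_n.

Let blt (i : 'I_n) : block_label b i < size b. Proof. by apply: block_label_lt; rewrite bn. Qed.
Let alt (i : 'I_n) : block_label a i < size a. Proof. by apply: block_label_lt; rewrite an. Qed.

Lemma youngE s w : sumn s = n ->
  reflect (forall i, block_label s (w i) = block_label s i) (w \in young n s).
Proof.
move=> sn; rewrite inE; apply: (iffP forallP) => H i.
  by apply/eqP; rewrite block_label_eq ?sn //; apply: H.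
by rewrite -block_label_eq ?sn // H.
Qed.

Definition block_count w p q : nat :=
  #|[set i : 'I_n | (block_label b i == p) && (block_label a (w i) == q)]|.

Definition block_mat w : seq (seq nat) :=
  mkseq (fun p => mkseq (block_count w p) (size a)) (size b).

Lemma nth_block_mat w p q : p < size b -> q < size a ->
  nth 0 (nth [::] (block_mat w) p) q = block_count w p q.
Proof. by move=> pb qa; rewrite !nth_mkseq. Qed.

Lemma block_mat_in w : block_mat w \in margin_mats (rev b) (rev a).
Proof.
apply/mem_margin_mats; split=> [|c /mapP[p _ ->]|q].
- rewrite -[RHS](mkseq_nth 0) /block_mat /mkseq -map_comp size_rev; apply/eq_in_map => p.
  rewrite mem_iota => /= pb; rewrite (@sumn_nth _ (size a)) ?size_mkseq //.
  under eq_bigr => q _ do rewrite nth_mkseq //.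
  rewrite (sum_card_fiber (f := fun i : 'I_n => block_label a (w i)) (Q := predT)) => [|i _].
    by rewrite -card_block_label bn.
  by rewrite alt.
- by rewrite size_mkseq size_rev.
rewrite /block_mat big_map.
have [qa|qa] := ltnP q (size a); last first.
  by rewrite big1_seq ?nth_default ?size_rev // => p _; rewrite nth_default ?size_mkseq.
under eq_bigr => p _ do rewrite nth_mkseq //.
rewrite big_iota_ord -card_block_label an -(card_perm_set w (fun i => block_label a i == q)).
rewrite -[RHS](sum_card_fiber (f := fun i : 'I_n => block_label b i) (Q := predT) (l := size b)) => [|i _].
  by apply: eq_bigr => p _; apply: eq_card => i; rewrite !inE andbC.
by rewrite blt.
Qed.

(** In the list containing each (p, q) with multiplicity M_pq, first coordinates have the fibre
    sizes of the [b]-labels and second coordinates those of the [a]-labels; composing the two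
    resulting matchings gives [w]. *)
Lemma block_mat_surj M : M \in margin_mats (rev b) (rev a) -> exists w, block_mat w = M.
Proof.
case/mem_margin_mats; rewrite size_rev => Mb Msz Ma.
have szM : size M = size b by rewrite -(size_rev b) -Mb size_map.
pose L := flatten [seq nseq (nth 0 (nth [::] M p) q) (p, q) |
  p <- iota 0 (size b), q <- iota 0 (size a)].
have cntL P : count P L = \sum_(p < size b) \sum_(q < size a)
    P (p : nat, q : nat) * nth 0 (nth [::] M p) q.
  rewrite count_flatten sumnE big_map big_allpairs_dep big_iota_ord.
  apply: eq_bigr => p _; rewrite big_iota_ord; apply: eq_bigr => q _.
  by rewrite count_nseq.
have rowM p : p < size b -> \sum_(q < size a) nth 0 (nth [::] M p) q = nth 0 (rev b) p.
  move=> pb; rewrite -Mb (nth_map [::]) ?szM // (@sumn_nth _ (size a)) //.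
  by rewrite Msz ?mem_nth ?szM.
have colM q : \sum_(p < size b) nth 0 (nth [::] M p) q = nth 0 (rev a) q.
  by rewrite -Ma (big_nth [::]) big_mkord szM.
have szL : size L = n.
  rewrite -count_predT cntL -bn -sumn_rev (@sumn_nth (rev b) (size b)) ?size_rev //.
  by apply: eq_bigr => p _; rewrite -rowM //; apply: eq_bigr => q _; rewrite mul1n.
pose f (i : 'I_n) := nth (0, 0) L i.
have fP P : #|[set i | P (f i)]| = count P L.
  rewrite (card_ord_count n (fun i => P (nth (0, 0) L i))) -szL.
  by rewrite -[in RHS](mkseq_nth (0, 0) L) /mkseq count_map.
have [s sE] : exists s : 'S_n, forall i : 'I_n, block_label b i = (f (s i)).1.
  apply: (eq_fibers_perm (f := fun i => (f i).1) (g := fun i : 'I_n => block_label b i)) => p.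
  rewrite (fP (fun x => x.1 == p)) -[RHS](_ : nth 0 (rev b) p = _); last first.
    by rewrite -card_block_label bn.
  rewrite cntL; have [pb|pb] := ltnP p (size b).
    rewrite -rowM // (bigD1 (Ordinal pb)) //= eqxx [X in _ + X]big1 ?addn0 => [|p' np].
      by apply: eq_bigr => q _; rewrite mul1n.
    by apply: big1 => q _; rewrite -val_eqE /= in np; rewrite (negPf np).
  rewrite nth_default ?size_rev // big1 // => p' _; apply: big1 => q _.
  by rewrite /= ltn_eqF ?(leq_trans _ pb).
have [t tE] : exists t : 'S_n, forall i : 'I_n, block_label a i = (f (t i)).2.
  apply: (eq_fibers_perm (f := fun i => (f i).2) (g := fun i : 'I_n => block_label a i)) => q.
  rewrite (fP (fun x => x.2 == q)) -[RHS](_ : nth 0 (rev a) q = _); last first.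
    by rewrite -card_block_label an.
  rewrite cntL exchange_big /=; have [qa|qa] := ltnP q (size a).
    rewrite -colM // (bigD1 (Ordinal qa)) //= eqxx [X in _ + X]big1 ?addn0 => [|q' nq].
      by apply: eq_bigr => p _; rewrite mul1n.
    by apply: big1 => p _; rewrite -val_eqE /= in nq; rewrite (negPf nq).
  rewrite nth_default ?size_rev // big1 // => q' _; apply: big1 => p _.
  by rewrite /= ltn_eqF ?(leq_trans _ qa).
exists (s * t^-1)%g; apply: (@eq_from_nth _ [::]); rewrite size_mkseq // => p pb.
apply: (@eq_from_nth _ 0); rewrite nth_mkseq // size_mkseq ?Msz ?mem_nth ?szM // => q qa.
rewrite nth_mkseq // /block_count.
transitivity #|[set i | f (s i) == (p, q)]|.
  apply: eq_card => i; rewrite !inE sE tE permM permKV.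
  by case: (f (s i)).
rewrite (card_perm_set s (fun i => f i == (p, q))) (fP (pred1 (p, q))) cntL.
rewrite (bigD1 (Ordinal pb)) //= (bigD1 (Ordinal qa)) //= eqxx mul1n.
rewrite [X in _ + X + _]big1 ?[X in _ + X]big1 ?addn0 // => i ni; rewrite -val_eqE /= in ni.
  by apply: big1 => j _; rewrite /= xpair_eqE (negPf ni).
by rewrite /= xpair_eqE (negPf ni) andbF.
Qed.

Local Open Scope group_scope.

Lemma double_cosetP w w' : reflect
  (exists x y, [/\ x \in young n b, y \in young n a & w' = x * w * y])
  (w' \in young n b :* w * young n a).
Proof.
apply: (iffP mulsgP) => [[u y /rcosetP[x xb ->] ya ->]|[x [y [xb ya ->]]]].
  by exists x, y.
by exists (x * w) y => //; apply/rcosetP; exists x.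
Qed.

(** If the matrices agree, the maps sending i to the labels of i and of its image have equal fibre
    sizes. This yields a permutation [s] in the first Young subgroup, and the factor from the second
    one is then forced. *)
Lemma block_mat_coset w w' :
  (w' \in young n b :* w * young n a) = (block_mat w' == block_mat w).
Proof.
apply/double_cosetP/eqP => [[x [y [/(youngE _ bn) xb /(youngE _ an) ya ->]]]|E].
  apply/eq_in_map => p _; apply/eq_in_map => q _.
  rewrite -[RHS](card_perm_set x (fun i => (block_label b i == p) && (block_label a (w i) == q))).
  by apply: eq_card => i; rewrite !inE !permM ya xb.
have [s sE] : exists s : 'S_n, forall i : 'I_n,
    (block_label b i, block_label a (w' i)) = (block_label b (s i), block_label a (w (s i))).
  apply: (eq_fibers_perm (f := fun i : 'I_n => (block_label b i, block_label a (w i)))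
    (g := fun i : 'I_n => (block_label b i, block_label a (w' i)))) => -[p q].
  have countE (v : 'S_n) : #|[set i : 'I_n | (block_label b i, block_label a (v i)) == (p, q)]| =
      block_count v p q.
    by apply: eq_card => i; rewrite !inE xpair_eqE.
  rewrite !countE; have [pb|pb] := ltnP p (size b); last first.
    by rewrite /block_count !eq_card0 // => i; rewrite !inE ltn_eqF ?(leq_trans _ pb).
  have [qa|qa] := ltnP q (size a); last first.
    rewrite /block_count !eq_card0 // => i; rewrite !inE andbC ltn_eqF //;
    exact: leq_trans (alt _) qa.
  by rewrite -nth_block_mat // -E nth_block_mat.
exists s, (w^-1 * s^-1 * w'); split.
- by apply/youngE => // i; have [<-] := sE i.
- apply/youngE => // i; have := sE (s^-1 (w^-1 i)); rewrite permKV permKV => -[_].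
  by rewrite !permM.
by rewrite !mulgA mulgK mulgV mul1g.
Qed.

(** A descent between neighbours of one block could be removed by a simple transposition of the
    Young subgroup, giving a shorter element. *)
Lemma young_min_increasing s (v : 'S_n) : sumn s = n ->
    (forall t, t \in young n s -> coxeter_length v <= coxeter_length (t * v))%N ->
  forall i j : 'I_n, (i < j)%N -> block_label s i = block_label s j -> (v i < v j)%N.
Proof.
move=> sn vmin.
apply: (ltn_convex_class (f := fun i => v i)
  (b := fun i : 'I_n => block_label s i)).
  move=> i l j /andP[il lj] E; apply/eqP; rewrite eqn_leq block_label_ge //= E.
  exact: block_label_ge.
move=> i j ij E; rewrite ltnNge; apply/negP => ji.
have vji : (v j < v i)%N.
  rewrite ltn_neqAle ji andbT; apply/negP => /eqP/val_inj/perm_inj ji'.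
  by move: ij; rewrite ji' => /n_Sn.
have tin : tperm i j \in young n s.
  by apply/(youngE _ sn) => l; case: tpermP => [->|->|].
have := vmin _ tin; rewrite !coxeter_lengthE.
by have := card_inv_tperm v ij; rewrite vji [(v i < v j)%N]ltnNge ltnW //= addn0 addn1 => <-;
  rewrite ltnn.
Qed.

(** By monotonicity the two positions of an inversion lie in different [b]-blocks and their images
    in different [a]-blocks, so inversions are counted by pairs of matrix entries. *)
Lemma card_inv_block_mat (m : 'S_n) :
    (forall i j : 'I_n, i < j -> block_label b i = block_label b j -> m i < m j)%N ->
    (forall i j : 'I_n, i < j -> block_label a i = block_label a j -> m^-1%g i < m^-1%g j)%N ->
  #|inv_set m| = mat_inv (block_mat m).
Proof.
move=> mb ma.
pose R (z : 'I_n * 'I_n) :=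
  (block_label b z.1 < block_label b z.2)%N && (block_label a (m z.2) < block_label a (m z.1))%N.
transitivity #|[set z | R z]|.
  (* Labels decrease along positions, so the two members of an inversion are exchanged. *)
  have swK : involutive (fun z : 'I_n * 'I_n => (z.2, z.1)) by case.
  rewrite -(card_preimset [set z | R z] (inv_inj swK)); apply: eq_card => -[x y].
  rewrite !inE /R /=; apply/andP/andP => -[lt1 lt2].
    split; rewrite ltn_neqAle block_label_ge 1?ltnW // andbT; apply/eqP => E.
      by have := mb _ _ lt1 (esym E); rewrite ltnNge ltnW.
    by have := ma _ _ lt2 (esym E); rewrite !permK ltnNge ltnW.
  split; rewrite ltnNge; apply/negP => /block_label_ge.
    by move/(_ b); rewrite leqNgt lt1.
  by move/(_ a); rewrite leqNgt lt2.
rewrite (@mat_invE _ (size a)) => [|c /mapP[p _ ->]]; last by rewrite size_mkseq.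
rewrite size_mkseq.
rewrite -(sum_card_fiber (f := fun z : 'I_n * 'I_n => block_label b z.1)
  (Q := predT) (l := size b)) => [|z _];
  last by rewrite blt.
apply: eq_bigr => p _.
rewrite -(sum_card_fiber (f := fun z : 'I_n * 'I_n => block_label b z.2) (Q := fun p' => (p < p')%N)
  (l := size b)) => [|z /andP[/andP[zb _] /eqP <-]]; last by rewrite blt.
apply: eq_bigr => p' pp'.
rewrite -(sum_card_fiber (f := fun z : 'I_n * 'I_n => block_label a (m z.1))
  (Q := predT) (l := size a)) => [|z _];
  last by rewrite alt.
apply: eq_bigr => q _.
rewrite -(sum_card_fiber (f := fun z : 'I_n * 'I_n => block_label a (m z.2)) (Q := fun q' => (q' < q)%N)
  (l := size a)) => [|z /andP[/andP[/andP[/andP[_ za] _] _] /eqP <-]]; last by rewrite alt.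
apply: eq_bigr => q' qq'; rewrite !nth_block_mat // -cardsX.
apply: eq_card => -[x y]; rewrite in_setX !inE /R /=.
case: eqP => [->|]; rewrite ?andbF //; case: (block_label b y =P _) => [->|]; rewrite ?andbF //.
case: eqP => [->|]; rewrite ?andbF //; case: (block_label a (m y) =P _) => [->|]; rewrite ?andbF //.
by rewrite pp' qq'.
Qed.

Definition min_elt (c : {set 'S_n}) : 'S_n := [arg min_(w < repr c in c) coxeter_length w].

Lemma min_eltP (c : {set 'S_n}) : c \in double_cosets n b a ->
  min_elt c \in c /\ forall v, v \in c -> (coxeter_length (min_elt c) <= coxeter_length v)%N.
Proof.
move=> /double_coset_neq0/set0Pn[x cx]; rewrite /min_elt.
by case: arg_minnP => [|m mc H]; [exact: mem_repr cx|split=> // v vc; apply: H].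
Qed.

Lemma mem_double_coset (c : {set 'S_n}) w v : c \in double_cosets n b a -> w \in c ->
  (v \in c) = (block_mat v == block_mat w).
Proof.
by case/imsetP => u _ ->; rewrite !block_mat_coset => /eqP ->.
Qed.

(** A shortest element is minimal under [young n b] on the left and [young n a] on the right; the
    second condition is applied to its inverse. *)
Lemma coset_lengthE (c : {set 'S_n}) : c \in double_cosets n b a ->
  coset_length c = mat_inv (block_mat (min_elt c)).
Proof.
move=> cin; have [mc mmin] := min_eltP cin.
rewrite /coset_length -/(min_elt c) coxeter_lengthE; apply: card_inv_block_mat.
  apply: (young_min_increasing bn) => t tb; apply: mmin.
  case/imsetP: cin mc => w _ E; rewrite E => /double_cosetP[x [y [xb ya ->]]].
  apply/double_cosetP; exists (t * x), y; split=> //; first exact: groupM.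
  by rewrite !mulgA.
apply: (young_min_increasing an) => t ta.
rewrite coxeter_lengthV -[t * _]invgK coxeter_lengthV invMg invgK; apply: mmin.
case/imsetP: cin mc => w _ E; rewrite E => /double_cosetP[x [y [xb ya ->]]].
apply/double_cosetP; exists x, (y * t^-1); split=> //; first by rewrite groupM ?groupV.
by rewrite !mulgA.
Qed.

Lemma perm_block_mats :
  perm_eq [seq block_mat (min_elt c) | c in double_cosets n b a] (margin_mats (rev b) (rev a)).
Proof.
apply: uniq_perm; first 2 last.
- move=> M; apply/imageP/idP => [[c _ ->]|/block_mat_surj[w <-]]; first exact: block_mat_in.
  pose c := young n b :* w * young n a.
  have cin : c \in double_cosets n b a by apply/imsetP; exists w.
  exists c => //; apply/eqP; rewrite -(mem_double_coset w cin) ?(min_eltP cin).1 //.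
  by rewrite block_mat_coset.
- rewrite map_inj_in_uniq ?enum_uniq // => c c'; rewrite !mem_enum => cin cin' E.
  have [mc _] := min_eltP cin; have [mc' _] := min_eltP cin'.
  apply/setP => v; rewrite (mem_double_coset v cin mc) (mem_double_coset v cin' mc').
  by rewrite E.
exact: margin_mats_uniq.
Qed.

End Cosets.

(** The reversals come from [block_label], which numbers blocks from the last one. *)
Lemma hform_signed_mats b a : sumn b = sumn a -> hform b a = signed_mats (rev b) (rev a).
Proof.
move=> ba; rewrite /hform ba eqxx signed_matsE -(perm_big _ (perm_block_mats ba (erefl _))).
rewrite big_map big_enum; apply: eq_bigr => c cin.
by rewrite (coset_lengthE ba (erefl _)).
Qed.

(** * Odd Schur functions *)

Lemma nstat_cons x s : nstat (x :: s) = nstat s + sumn s.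
Proof.
rewrite /nstat big_ord_recl /= (sumn_nth (N := size s)) // -big_split /=.
by apply: eq_bigr => i _; rewrite /bump leq0n add1n mulSn addnC.
Qed.

Lemma sum_count_ltn x s : all (fun y => y <= x) s ->
  \sum_(j < x) count (fun y => j < y) s = sumn s.
Proof.
elim: s => [|y s IH] /=; first by rewrite big1.
case/andP=> yx /IH {}IH; rewrite big_split IH /=; congr (_ + _).
rewrite -(big_mkord xpredT (fun j => (j < y)%N : nat)).
rewrite -(subnKC yx) /index_iota subn0 iotaD big_cat /= [X in _ + X]big1_seq ?addn0.
  rewrite big_seq (eq_bigr (fun=> 1)) => [|i]; last by rewrite mem_iota => /= ->.
  by rewrite -big_seq sum1_size size_iota.
by move=> i /andP[_]; rewrite mem_iota => /andP[yi _]; rewrite ltnNge yi.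
Qed.

(** A new top row of length [x] adds one box to each of the first [x] columns. As C(c + 1, 2) = C(c,
    2) + c, the growth is the sum of the old column lengths c, which is [sumn s]. *)
Lemma binom2_conj_part s : is_part s -> binom2 (conj_part s) = nstat s.
Proof.
rewrite /binom2 /conj_part => ps; rewrite big_map big_iota_ord.
elim: s ps => [|x s IH]; first by rewrite /nstat !big_ord0.
rewrite is_part_cons nstat_cons => /and3P[_ hx ps].
have sx : all (fun y => y <= x) s.
  apply/allP => y /(nthP 0)[i _ <-]; apply: leq_trans hx; rewrite -nth0.
  by apply: (nonincreasing_le (f := nth 0 s)) => // i'; apply: is_part_nthS.
rewrite -IH // -(sum_count_ltn sx) /=.
rewrite [in RHS](@big_ord_stable (fun j => 'C(count (fun y => j < y) s, 2)) _ x) //.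
  rewrite -big_split /=; apply: eq_bigr => j _.
  by rewrite ltn_ord /= add1n binS bin1.
move=> i le; rewrite (_ : count _ s = 0) //; apply/eqP; rewrite eqn0Ngt -has_count.
apply/hasPn => y /(nthP 0)[l _ <-]; rewrite -leqNgt (leq_trans _ le) // -nth0.
by apply: (nonincreasing_le (f := nth 0 s)) => // i'; apply: is_part_nthS.
Qed.

Lemma tab_sign_sqr T : (tab_sign T * tab_sign T = 1)%R.
Proof. by rewrite -expr2 sqrr_sign. Qed.

(** The factor [tab_sign (superstandard la)] occurs twice and squares to 1, which leaves
    [odd_cauchy]. *)
Lemma hform_odd_kostka n (mu nu : intpart n) :
  (hform mu nu = \sum_(la : intpart n)
     sgn (nstat la) * (odd_kostka la mu * odd_kostka la nu))%R.
Proof.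
have /andP[/andP[_ mu0] /eqP mun] := valP mu.
have /andP[/andP[_ nu0] /eqP nun] := valP nu.
rewrite hform_signed_mats ?mun ?nun // odd_cauchy ?sumn_rev ?mun ?nun // big_parts.
apply: eq_bigr => la _; have /andP[pla _] := valP la.
by rewrite /odd_kostka !sum_tab_sign // mulrACA tab_sign_sqr mul1r.
Qed.

(** * Unitriangularity of the odd Kostka matrix *)

Lemma row_min i (r : seq nat) : (forall x, x \in r -> i < x) ->
  i * size r <= \sum_(x <- r) x.-1 ?= iff (r == nseq (size r) i.+1).
Proof.
elim: r => [|x r IH] H; first by rewrite muln0 big_nil.
rewrite big_cons /= mulnS eqseq_cons; apply: leqif_add.
  have := H x; rewrite inE eqxx => /(_ isT); case: x {H} => //= x ix.
  by rewrite eqSS eq_sym; exact: leqif_eq.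
by apply: IH => y yr; apply: H; rewrite inE yr orbT.
Qed.

Lemma sum_pred_content (T : seq (seq nat)) : 0 \notin flatten T ->
  \sum_(x <- flatten T) x.-1 = nstat (content T).
Proof.
move=> T0; transitivity (\sum_(i < size (content T)) \sum_(x <- flatten T | x == i.+1) i).
  rewrite (exchange_big_dep xpredT) //= big_seq [RHS]big_seq; apply: eq_bigr => -[|x] xT.
    by rewrite xT in T0.
  have lt : x < size (content T) by exact: leq_max_content.
  by rewrite (big_pred1 (Ordinal lt)) // => i /=; rewrite eqSS eq_sym -val_eqE.
apply: eq_bigr => i _; rewrite big_const_seq iter_addn_0; congr (_ * _).
exact: count_content.
Qed.

(** Both sides are compared through the sum of x - 1 over the entries x, where row i has entries at
    least i+1. Thus n plays the part of the dominance order. *)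
Lemma nstat_shape_content (T : seq (seq nat)) : semistandard T ->
  nstat (shape T) <= nstat (content T) ?= iff (T == superstandard (shape T)).
Proof.
move=> sT; have [_ T0 _ _] := and4P sT.
rewrite -sum_pred_content // /nstat size_map big_flatten (big_nth [::]) big_mkord.
have H (i : 'I_(size T)) : true -> i * nth 0 (shape T) i <=
    \sum_(x <- nth [::] T i) x.-1 ?= iff (nth [::] T i == nseq (nth 0 (shape T) i) i.+1).
  move=> _; rewrite nth_shape; apply: row_min => x /(nthP 0)[j jlt <-].
  exact: ssyt_entry_ge.
have [le eq] := leqif_sum H; split=> //; rewrite eq.
apply/forallP/eqP => [E|E i] /=.
  apply: (@eq_from_nth _ [::]) => [|i ilt]; first by rewrite size_mkseq size_map.
  by rewrite nth_mkseq ?size_map // (eqP (E (Ordinal ilt))).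
by have := congr1 (fun U => nth [::] U i) E; rewrite /superstandard nth_mkseq ?size_map // => ->.
Qed.

Lemma odd_kostka_neq0 la mu : odd_kostka la mu != 0%R ->
  nstat la <= nstat mu /\ (nstat la = nstat mu -> is_part la -> la = mu).
Proof.
rewrite /odd_kostka mulf_eq0 negb_or => /andP[_].
case: (pickP (predT : pred (ssyt la mu))) => [T _ _|none]; last by rewrite big_pred0 ?eqxx.
have /and3P[sT /eqP shT /eqP cT] := valP T.
have [] := nstat_shape_content sT; rewrite shT cT => le eqT; split=> // /eqP E pla.
rewrite -cT; move: E; rewrite eqT => /eqP ->.
by have /and3P[_ _ /eqP] := superstandard_ssyt pla.
Qed.

Lemma odd_kostka_diag la : is_part la -> odd_kostka la la = 1%R.
Proof.
move=> pla; rewrite /odd_kostka.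
rewrite (big_pred1 (Ssyt (superstandard_ssyt pla))) ?tab_sign_sqr // => T /=.
by apply/esym/eqP/val_inj; exact: superstandard_uniq.
Qed.

Section KostkaMatrix.
Variable n : nat.
Local Open Scope ring_scope.

Definition part_at (i : 'I_#|{: intpart n}|) : intpart n := enum_val i.

Definition kostka_mx : 'M[int]_#|{: intpart n}| :=
  \matrix_(i, j) odd_kostka (part_at i) (part_at j).

(** In the Leibniz expansion a nonzero term for [s] needs n at i to be at most n at s(i) for every
    i. Both sides have the same total, so equality holds throughout and [s] is the identity. *)
Lemma kostka_mx_det : \det kostka_mx = 1.
Proof.
rewrite /determinant (bigD1 1%g) //= odd_perm1 mul1r.
rewrite big1 => [|i _]; last first.
  by rewrite perm1 mxE odd_kostka_diag //; case/andP: (valP (part_at i)).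
rewrite big1 ?addr0 // => s s1; apply/eqP; rewrite mulf_eq0 signr_eq0 /=.
apply: contraNT s1 => /prodf_neq0 nz; apply/eqP/permP => i; rewrite perm1.
pose r (j : 'I_#|{: intpart n}|) := nstat (part_at j).
have le (j : 'I_#|{: intpart n}|) : true -> (r j <= r (s j) ?= iff (r j == r (s j)))%N.
  by move=> _; have := nz j isT; rewrite mxE => /odd_kostka_neq0[].
have [_] := leqif_sum le; rewrite [X in _ == X](_ : _ = \sum_j r j)%N; last first.
  by rewrite [RHS](reindex_inj (@perm_inj _ s)).
rewrite eqxx => /esym/forallP/(_ i)/eqP E.
have := nz i isT; rewrite mxE => /odd_kostka_neq0[_] /(_ E).
by case/andP: (valP (part_at i)) => -> _ /(_ isT)/val_inj/enum_val_inj.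
Qed.
End KostkaMatrix.

Local Open Scope ring_scope.

(** * The odd Schur functions and their Gram matrix *)

Section OddSymTheory.
Variable k : comNzRingType.

Lemma odd_formC (x y : odd_sym k) : odd_form x y = odd_form y x.
Proof. exact: Defs.formC. Qed.

Lemma odd_form_lin (c : k) (x y z : odd_sym k) :
  odd_form (c *: x + y) z = c * odd_form x z + odd_form y z.
Proof.
rewrite -[x]odd_reprK -[y]odd_reprK -[z]odd_reprK.
rewrite [c *: _]odd_scale_pi -odd_piD !odd_form_pi.
by rewrite Defs.formDl Defs.formZl.
Qed.

Lemma odd_form_suml (I : Type) (r : seq I) (c : I -> k) (x : I -> odd_sym k) z :
  odd_form (\sum_(i <- r) c i *: x i) z = \sum_(i <- r) c i * odd_form (x i) z.
Proof.
elim: r => [|i r IH]; last by rewrite !big_cons odd_form_lin IH.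
(* Linearity with scalar -1 at zero vectors gives [odd_form 0 z = 0]. *)
rewrite !big_nil; have := odd_form_lin (-1) 0 0 z.
by rewrite scaler0 addr0 mulN1r addNr.
Qed.

Lemma odd_graded_lin m (c : k) (x y : odd_sym k) :
  odd_graded m x -> odd_graded m y -> odd_graded m (c *: x + y).
Proof.
move=> [f hf ->] [g hg ->]; exists (c *: f + g); last first.
  by rewrite [c *: odd_pi _]odd_scale_pi odd_piD.
move=> u /(fsubsetP (msuppD_le _ _)); rewrite in_fsetU => /orP[|/hg //].
by move/(fsubsetP (msuppZ_le _ _))/hf.
Qed.

Lemma odd_graded_sum m (I : Type) (r : seq I) (c : I -> k) (x : I -> odd_sym k) :
  (forall i, odd_graded m (x i)) -> odd_graded m (\sum_(i <- r) c i *: x i).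
Proof.
move=> hx; elim: r => [|i r IH]; last by rewrite big_cons; apply: odd_graded_lin.
rewrite big_nil; exists 0; last by apply: (@addrI _ (odd_pi 0)); rewrite -odd_piD !addr0.
by move=> u; rewrite msupp0.
Qed.

Lemma odd_graded_hprod n (mu : intpart n) : odd_graded n (odd_pi (hprod k mu)).
Proof.
have /andP[/andP[_ mu0] /eqP mun] := valP mu.
have [u ua uE] := hprod_mono k mu0; exists (hprod k mu) => // v.
by rewrite uE msuppU1 in_fset1 => /eqP ->; rewrite ua.
Qed.

Variable n : nat.
Local Notation N := #|{: intpart n}|.

Definition kostka_mxk : 'M[k]_N := map_mx intr (kostka_mx n).

(** The inverse is taken over the integers, where the determinant is 1, and then mapped to [k]. *)
Definition kostka_invk : 'M[k]_N := map_mx intr (invmx (kostka_mx n)).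

Let kostka_unit : kostka_mx n \in unitmx.
Proof. by rewrite unitmxE kostka_mx_det unitr1. Qed.

Lemma kostka_mulV : kostka_mxk *m kostka_invk = 1%:M.
Proof. by rewrite -map_mxM mulmxV // map_mx1. Qed.

Lemma kostka_Vmul : kostka_invk *m kostka_mxk = 1%:M.
Proof. by rewrite -map_mxM mulVmx // map_mx1. Qed.

Lemma sum_part_at (V : nmodType) (F : intpart n -> V) :
  \sum_(la : intpart n) F la = \sum_i F (part_at i).
Proof. exact: big_enum_val. Qed.

(** [xget] returns a solution as soon as one exists. *)
Lemma odd_schurP : is_odd_schur (odd_schur k n).
Proof.
apply: (@classical_sets.xgetPex _ _ (fun s => is_odd_schur s)).
(* The inverted system: s_la is the sum of (K^-1)_(mu, la) h_mu over mu. *)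
exists [ffun la => \sum_i kostka_invk i (enum_rank la) *: odd_pi (hprod k (part_at i))].
split=> [la|mu].
  by rewrite ffunE; apply: odd_graded_sum => i; apply: odd_graded_hprod.
rewrite sum_part_at.
under eq_bigr => i _ do rewrite ffunE scaler_sumr.
rewrite exchange_big /=.
have E i : \sum_j (odd_kostka (part_at j) mu)%:~R *:
     (kostka_invk i (enum_rank (part_at j)) *: odd_pi (hprod k (part_at i))) =
   (i == enum_rank mu)%:R *: odd_pi (hprod k (part_at i)).
  under eq_bigr do rewrite scalerA; rewrite -scaler_suml; congr (_ *: _).
  have := congr1 (fun A : 'M_N => A i (enum_rank mu)) kostka_Vmul.
  rewrite /= !mxE => <-; apply: eq_bigr => j _.
  by rewrite !mxE /part_at enum_rankK enum_valK mulrC.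
rewrite (eq_bigr _ (fun i _ => E i)) (bigD1 (enum_rank mu)) //= eqxx scale1r.
rewrite big1 ?addr0 => [|i /negPf ->]; last by rewrite scale0r.
by rewrite /part_at enum_rankK.
Qed.

Lemma odd_form_hprod (mu nu : intpart n) :
  odd_form (odd_pi (hprod k mu)) (odd_pi (hprod k nu)) = (hform mu nu)%:~R.
Proof.
have /andP[/andP[_ mu0] _] := valP mu; have /andP[/andP[_ nu0] _] := valP nu.
by rewrite odd_form_pi form_hprod.
Qed.

(** With K the Kostka matrix, K^T B K and K^T D K are both the Gram matrix of the h_mu, one by the
    definition of the s_la and the other by [hform_odd_kostka]; then K cancels. *)
Lemma odd_schur_gram :
  \matrix_(i, j) odd_form (odd_schur k n (part_at i)) (odd_schur k n (part_at j)) =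
  diag_mx (\row_i (-1) ^+ nstat (part_at i)) :> 'M[k]_N.
Proof.
set B := \matrix_(i, j) _; set D := diag_mx _.
have [_ hs] := odd_schurP.
suff E : kostka_mxk^T *m B *m kostka_mxk = kostka_mxk^T *m D *m kostka_mxk.
  have := congr1 (fun A => kostka_invk^T *m A *m kostka_invk) E.
  by rewrite /= !mulmxA -!trmx_mul kostka_mulV trmx1 !mul1mx -!mulmxA kostka_mulV !mulmx1.
transitivity (\matrix_(i, j) (hform (part_at i) (part_at j))%:~R : 'M[k]_N).
  apply/matrixP => i j; rewrite mxE.
  rewrite [RHS]mxE -odd_form_hprod !hs !sum_part_at odd_form_suml.
  under eq_bigr => l _ do rewrite mxE big_distrl /=.
  rewrite exchange_big /=; apply: eq_bigr => l _.
  rewrite odd_formC odd_form_suml mulr_sumr; apply: eq_bigr => m _.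
  by rewrite !mxE odd_formC -!mulrA; congr (_ * _); rewrite mulrC.
apply/matrixP => i j; rewrite mxE hform_odd_kostka sum_part_at.
rewrite rmorph_sum [RHS]mxE; apply: eq_bigr => l _.
rewrite mul_mx_diag !mxE !rmorphM rmorphXn rmorphN1.
by rewrite mulrCA mulrA.
Qed.

End OddSymTheory.

Theorem corollary3p9 (k : comNzRingType) (n : nat) (la mu : intpart n) :
  odd_form (odd_schur k n la) (odd_schur k n mu) =
    (-1) ^+ binom2 (conj_part la) * (la == mu)%:R.
Proof.
have /andP[pla _] := valP la.
have := congr1 (fun A : 'M_#|{: intpart n}| => A (enum_rank la) (enum_rank mu))
  (odd_schur_gram k n).
rewrite /= !mxE /part_at !enum_rankK => ->.
by rewrite binom2_conj_part // (inj_eq enum_rank_inj) mulr_natr.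
Qed.
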